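(* Let $k$ be even, let $\pi=(\pi_t)_{t\in\{1,\ldots,T\}}$ be a partition of $\{1,\ldots,k\}$, and let $\varepsilon\in\{\cdot,-\}^k$ be a balanced sequence. For all $p,q\in P_k^\varepsilon$, we have the expansion $$\mathrm{Wg}[\pi](p,q,n)=(-1)^{|pq^{-1}|}\,n^{-k/2-|pq^{-1}|}\sum_{g\ge0}\big|P[\pi](p,q,2g)\big|\,n^{-2g},$$ meaning that the right-hand side is the power series expansion near $n=\infty$ of the rational function $n\mapsto\mathrm{Wg}[\pi](p,q,n)$.
   Context: The sequence $\varepsilon\in\{\cdot,-\}^k$ is balanced if it has as many $\cdot$ as $-$. $P_k^\varepsilon$ is the set of pair partitions of $\{1,\ldots,k\}$ each of whose pairs matches an index $i$ with $\varepsilon_i=\cdot$ to an index $i'$ with $\varepsilon_{i'}=-$; such a $p$ is identified with a bijection from $\{i:\varepsilon_i=\cdot\}$ to $D=\{i:\varepsilon_i=-\}$, so that for $p,q\in P_k^\varepsilon$, $pq^{-1}$ is a permutation of $D$, a set with $k/2$ elements. For a permutation $\sigma$ of a finite set $S$, $|\sigma|=|S|-(\text{number of cycles of }\sigma)$. Weingarten functions. For $m\ge1$ and $n\ge m$, $\mathrm{Wg}(\cdot,n):S_m\to\mathbb{R}$ is the unitary Weingarten function, i.e. the unique central function such that, for $U$ Haar-distributed on $\mathbb{U}_n$, $\mathbf{E}\prod_{l=1}^mU_{x_ly_l}\overline U_{x'_ly'_l}=\sum_{p,q\in S_m}\prod_l\delta_{x_l,x'_{p(l)}}\prod_l\delta_{y_l,y'_{q(l)}}\mathrm{Wg}(pq^{-1},n)$;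 for fixed $\sigma$ it is a rational function of $n$. It is defined likewise for permutations of any $m$-element set (it depends only on the cycle type), and equals $1$ for the empty set. For $A\subset\{1,\ldots,T\}$ let $\pi_A$ be the partition of $\{1,\ldots,k\}$ obtained from $\pi$ by merging all blocks $\pi_t$, $t\in A$, into one block and keeping the others. A pair partition $p$ leaves a set $b$ invariant if no pair of $p$ has exactly one element in $b$. Set $\mathrm{Wg}_A[\pi](p,q,n)=0$ if $p$ or $q$ does not leave all blocks of $\pi_A$ invariant, and otherwise $\mathrm{Wg}_A[\pi](p,q,n)=\prod_{b\in\pi_A}\mathrm{Wg}(p_bq_b^{-1},n)$, where $p_b,q_b$ are the restrictions of $p,q$ to the block $b$. The centered Weingarten function is $$\mathrm{Wg}[\pi](p,q,n)=\sum_{A\subset\{1,\ldots,T\}}(-1)^{T-|A|}\,\mathrm{Wg}_A[\pi](p,q,n).$$ (It satisfies $\mathbf{E}\prod_{t=1}^T[\prod_{i\in\pi_t}U_{x_iy_i}^{\varepsilon_i}]=\sum_{p,q\in P^\varepsilon_k}\delta_p(x)\delta_q(y)\mathrm{Wg}[\pi](p,q,n)$, with $[X]=X-\mathbf{E}X$, $z^\cdot=z$, $z^-=\bar z$, and $\delta_p(x)$ equal to $1$ if $i\mapsto x_i$ is constant on the pairs of $p$ and $0$ otherwise.) The sets $P[\pi](p,q,l)$. For $l\ge0$, $P[\pi](p,q,l)$ is the set of sequences of transpositions $(i_1,j_1),\ldots,(i_{|pq^{-1}|+l},j_{|pq^{-1}|+l})$ of elements of $D$ such that $$p=(i_1,j_1)\cdots(i_{|pq^{-1}|+l},j_{|pq^{-1}|+l})\,q,$$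 with $i_r<j_r$ for all $r$ and $j_r\le j_{r+1}$ for all $r$ (for the usual order on integers), and such that there is no block $b$ of $\pi$ for which $p$, $q$ and every transposition $(i_r,j_r)$ leave $b$ invariant (a transposition $(i_r,j_r)$ leaves $b$ invariant if $i_r,j_r$ are both in $b$ or both outside $b$). *)

(* Defs.v *)
From HB Require Import structures.
From mathcomp Require Import all_boot all_order all_algebra fingroup perm.
From mathcomp Require Import all_classical all_reals all_analysis.
From mathcomp Require Import spectral complex.

Set Implicit Arguments.
Unset Strict Implicit.
Unset Printing Implicit Defensive.

Import Order.TTheory GRing.Theory Num.Theory.
Import numFieldNormedType.Exports.

Local Open Scope classical_set_scope.
Local Open Scope ring_scope.

(** * Haar measure on the unitary group *)

Definition unitary_group (R : realType) (n : nat) : Type :=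
  {U : 'M[R[i]]_n | U \is unitarymx}.

Definition unitary_mx (R : realType) n (U : unitary_group R n) : 'M[R[i]]_n :=
  proj1_sig U.

HB.instance Definition _ (R : realType) n := Choice.on (unitary_group R n).

Fact unitarymx1 (R : realType) n : (1%:M : 'M[R[i]]_n) \is unitarymx.
Proof. by apply/unitarymxP; rewrite trmx1 map_mx1 mulmx1. Qed.

HB.instance Definition _ (R : realType) n :=
  isPointed.Build (unitary_group R n)
    (exist (fun U => U \is unitarymx) _ (unitarymx1 R n)).

Definition unitary_mul (R : realType) n (V U : unitary_group R n) :
    unitary_group R n :=
  exist (fun W => W \is unitarymx) (unitary_mx V *m unitary_mx U)
    (mul_unitarymx (valP V) (valP U)).

(* The Borel sigma-algebra of the unitary group is generated by the real and
   imaginary parts of the matrix entries. *)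
Definition unitary_entry_sets (R : realType) n : set (set (unitary_group R n)) :=
  [set B | exists (i j : 'I_n) (A : set R), measurable A /\
     (B = [set U | A (complex.Re (unitary_mx U i j))] \/
      B = [set U | A (complex.Im (unitary_mx U i j))])].

Definition unitary_borel (R : realType) (n : nat) :=
  g_sigma_algebraType (@unitary_entry_sets R n).

Definition haar_unitary (R : realType) (n : nat)
    (mu : probability (unitary_borel R n) R) : Prop :=
  forall (V : unitary_group R n) (B : set (unitary_borel R n)),
    measurable B -> mu (@unitary_mul R n V @^-1` B) = mu B.

Definition unitary_expect (R : realType) (n : nat)
    (mu : probability (unitary_borel R n) R) (f : 'M[R[i]]_n -> R[i]) : R[i] :=
  Complex (\int[mu]_U complex.Re (f (unitary_mx (U : unitary_group R n))))
          (\int[mu]_U complex.Im (f (unitary_mx (U : unitary_group R n)))).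

(** * Unitary Weingarten functions *)

(* In [perm], [(s * t) x = t (s x)]; hence [q^-1 * p] is the composition
   written p q^-1 when permutations are composed as functions. *)
Definition is_weingarten (R : realType) (m n : nat)
    (mu : probability (unitary_borel R n) R) (W : 'S_m -> R) : Prop :=
  (forall s t : 'S_m, W (s ^ t)%g = W s) /\
  (forall x y x' y' : 'I_m -> 'I_n,
     unitary_expect mu
       (fun U => \prod_(l < m) (U (x l) (y l) * (U (x' l) (y' l))^*)) =
     (\sum_(p : 'S_m) \sum_(q : 'S_m)
        (\prod_(l < m) (x l == x' (p l))%:R) *
        (\prod_(l < m) (y l == y' (q l))%:R) * W (q^-1 * p)%g)%:C%C).

(* [Wg m n] is Wg(., n) on S_m.  Nothing is assumed when [0 < m] and [n < m]. *)
Definition weingarten_family (R : realType)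
    (mu : forall n, probability (unitary_borel R n) R)
    (Wg : forall m : nat, nat -> 'S_m -> R) : Prop :=
  (forall n (s : 'S_0), Wg 0%N n s = 1) /\
  (forall m n, (0 < m <= n)%N -> is_weingarten (mu n) (Wg m n)).

Section FiniteSetPermutation.
Variables (S : finType) (s : {perm S}).

Definition ord_conj_fun (i : 'I_#|S|) : 'I_#|S| := enum_rank (s (enum_val i)).

Fact ord_conj_fun_inj : injective ord_conj_fun.
Proof. by move=> i j /enum_rank_inj /perm_inj /enum_val_inj. Qed.

Definition ord_conj : 'S_#|S| := perm ord_conj_fun_inj.

Definition perm_len : nat := (#|S| - #|porbits s|)%N.

End FiniteSetPermutation.

(* [Wg] is central, so the numbering of S used by [ord_conj] is irrelevant. *)
Definition wg_perm (R : realType) (Wg : forall m : nat, nat -> 'S_m -> R)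
    (S : finType) (n : nat) (s : {perm S}) : R :=
  Wg #|S| n (ord_conj s).

(** * Pair partitions *)

Local Close Scope classical_set_scope.
Local Open Scope set_scope.

Section PairPartitions.
Variable k : nat.

(* The letter "-" is [true] and the letter "." is [false]. *)
Implicit Type eps : {ffun 'I_k -> bool}.
Implicit Type p q : {set {set 'I_k}}.
Implicit Type b E : {set 'I_k}.

Definition minus_set eps : {set 'I_k} := [set i | eps i].

Definition balanced eps : bool :=
  #|[set i | ~~ eps i]| == #|[set i | eps i]|.

Definition pair_partitions eps : {set {set {set 'I_k}}} :=
  [set p : {set {set 'I_k}} | finset.partition p [set: 'I_k] &
     [forall c in p, [exists i, [exists i',
        [&& ~~ eps i, eps i' & c == [set i; i']]]]]].

(* For a pair partition p, the element paired with i; both the bijection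
   identified with p and its inverse are restrictions of it. *)
Definition partner p (i : 'I_k) : 'I_k :=
  odflt i [pick j | [set i; j] \in p].

(* The permutation p q^-1 of the set E of "-" indices of the set that p and q
   pair up (the default value 1 is never used for such p, q, E). *)
Definition quot_perm E p q : {perm {x | x \in E}} :=
  insubd (1%g : {perm {x | x \in E}})
    [ffun x : {x | x \in E} => insubd x (partner p (partner q (val x)))].

Definition pairs_invariant p b : bool :=
  [forall c in p, #|c :&: b| != 1%N].

Definition transp_invariant (ij : 'I_k * 'I_k) b : bool :=
  (ij.1 \in b) == (ij.2 \in b).

End PairPartitions.

(** * Centered Weingarten functions *)

Section Centered.
Variables (R : realType) (Wg : forall m : nat, nat -> 'S_m -> R).
Variables (k T : nat) (eps : {ffun 'I_k -> bool}) (pi : 'I_T -> {set 'I_k}).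
Implicit Type p q : {set {set 'I_k}}.

Definition labelled_partition : Prop :=
  injective pi /\ finset.partition [set pi t | t : 'I_T]%SET [set: 'I_k].

(* For A = set0 the union is set0, which is not a block. *)
Definition merge_blocks (A : {set 'I_T}) : {set {set 'I_k}} :=
  (((\bigcup_(t in A) pi t) |: [set pi t | t in ~: A]) :\ finset.set0)%SET.

(* [p ::&: b] is the restriction of p to b. *)
Definition wg_merged (A : {set 'I_T}) p q (n : nat) : R :=
  if [forall b in merge_blocks A, pairs_invariant p b && pairs_invariant q b]
  then \prod_(b in merge_blocks A)
         wg_perm Wg n (quot_perm (minus_set eps :&: b) (p ::&: b) (q ::&: b))
  else 0.

Definition centered_wg p q (n : nat) : R :=
  \sum_(A : {set 'I_T}) (-1) ^+ (T - #|A|) * wg_merged A p q n.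

End Centered.

(** * Sequences of transpositions *)

Section Paths.
Variables (k T : nat) (eps : {ffun 'I_k -> bool}) (pi : 'I_T -> {set 'I_k}).
Variables (p q : {set {set 'I_k}}).

Definition quot_len : nat := perm_len (quot_perm (minus_set eps) p q).

(* The equality p = (i_1 j_1) ... (i_r j_r) q is an equality of maps from the
   "." indices to the "-" indices, and q is applied first. *)
Definition wg_paths (l : nat) : {set (quot_len + l).-tuple ('I_k * 'I_k)} :=
  [set s : (quot_len + l).-tuple ('I_k * 'I_k) |
    [&& all (fun ij : 'I_k * 'I_k =>
               [&& ij.1 \in minus_set eps, ij.2 \in minus_set eps
                 & (ij.1 < ij.2)%N]) s,
        sorted (fun ij ij' : 'I_k * 'I_k => (ij.2 <= ij'.2)%N) s,
        [forall i, ~~ eps i ==>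
           (partner p i ==
            foldr (fun (ij : 'I_k * 'I_k) x => tperm ij.1 ij.2 x)
                  (partner q i) s)]
      & ~~ [exists t, [&& pairs_invariant p (pi t),
                          pairs_invariant q (pi t)
                        & all (fun ij => transp_invariant ij (pi t)) s]]]].

End Paths.

(* Main.v *)
Require Import Defs.
From mathcomp Require Import all_boot all_order all_algebra fingroup morphism perm action.
From mathcomp Require Import all_classical all_reals all_analysis.
From mathcomp Require Import measurable_realfun spectral complex polyrcf.
From mathcomp Require Import lra zify ring.

Set Implicit Arguments.
Unset Strict Implicit.
Unset Printing Implicit Defensive.

Import Order.TTheory GRing.Theory Num.Theory.
Import numFieldNormedType.Exports.
Local Open Scope ring_scope.

(* Integrating the row orthogonality relations of U shows that Wg(., n) is the
   convolution inverse of s |-> n^(number of cycles of s), for every n >= m.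
   Cramer's rule makes it a rational function of n whose denominator, the Gram
   determinant, does not vanish at these integers.

   Fix a colouring of {1..k}.  With y = 1/x, the function s |-> y^|s| on the
   colour preserving permutations is the product over j of the Jucys-Murphy
   factors 1 + y J_j, where J_j is the sum of the transpositions (i j) with i < j
   of the colour of j.  Inverting these factors as geometric series shows that
   the inverse function is the generating series of the monotone factorizations
   into colour preserving transpositions.  It is also the product over the colour
   classes of the (normalized) Weingarten functions, so it expands Wg_A[pi] when
   the colours of the "-" indices are the blocks of pi_A.

   The alternating sum over A is an inclusion-exclusion: it kills the
   factorizations which, together with p and q, leave some block invariant.
   Parity leaves only the lengths |p q^-1| + 2g. *)

(** * Length of a permutation *)

Lemma card_porbits_le (T : finType) (s : {perm T}) : (#|porbits s| <= #|T|)%N.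
Proof. exact: leq_imset_card. Qed.

Section PermLen.
Variables (T : finType) (s : {perm T}).
Implicit Types (x y : T) (r : T -> nat).

(** Ranking the points by an injective [r] gives each cycle exactly one minimal point, so [porbit s]
    is a bijection from the minimal points onto the cycles. *)
Lemma card_porbits_min r : injective r ->
  #|porbits s| = #|[set x | [forall y in porbit s x, r x <= r y]%N]%SET|.
Proof.
move=> r_inj; set M := [set x | _]%SET.
have porbit_inj : {in M &, injective (porbit s)}.
  move=> x y; rewrite !inE => /forall_inP xmin /forall_inP ymin exy.
  apply: r_inj; apply/eqP; rewrite eqn_leq xmin ?ymin //.
    by rewrite -eq_porbit_mem exy.
  by rewrite -eq_porbit_mem exy.
rewrite -(card_in_imset porbit_inj); congr #|pred_of_set _|.
apply/eqP; rewrite finset.eqEsubset; apply/andP; split; last first.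
  by apply/fintype.subsetP => _ /imsetP[x _ ->]; apply: imset_f.
apply/fintype.subsetP => _ /imsetP[x _ ->].
case: (arg_minnP r (porbit_id s x)) => y yx ymin.
apply/imsetP; exists y; last by apply/eqP; rewrite eq_sym eq_porbit_mem.
rewrite inE; apply/forall_inP => z zy; apply: ymin; move: zy.
have /eqP <- : porbit s y == porbit s x by rewrite eq_porbit_mem.
by [].
Qed.

(** In this form the length is a number of points, which makes it blind to added fixed points and
    additive over invariant sets. *)
Lemma perm_lenE r : injective r ->
  perm_len s = #|[set x | [exists y in porbit s x, r y < r x]%N]%SET|.
Proof.
move=> r_inj; rewrite /perm_len (card_porbits_min r_inj) -cardsT -cardsDS ?subsetT //.
apply: eq_card => x; rewrite !inE andbT negb_forall_in.
by apply: eq_existsb => y; rewrite ltnNge.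
Qed.

Lemma perm_lenV : perm_len s^-1 = perm_len s.
Proof. by rewrite /perm_len porbitsV. Qed.

(** Multiplying by a transposition of two points of one cycle splits this cycle in two. *)
Lemma perm_len_tperm x y : x != y -> x \in porbit s y ->
  perm_len s = (perm_len (tperm x y * s)%g).+1.
Proof.
move=> neq_xy xy; have := porbits_mul_tperm s x y; rewrite /= xy neq_xy /perm_len.
rewrite addn0 addn1 => e; have := card_porbits_le (tperm x y * s).
by rewrite e => lt; rewrite subnSK.
Qed.

Lemma odd_perm_len : odd (perm_len s) = s :> bool.
Proof. by rewrite /perm_len oddB ?card_porbits_le. Qed.

Lemma perm_len_mul_tperm_le x y :
  (perm_len (tperm x y * s)%g <= (perm_len s).+1)%N.
Proof.
have [<-|neq_xy] := eqVneq x y; first by rewrite tperm1 mul1g leqW.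
have := porbits_mul_tperm s x y; rewrite /= neq_xy /perm_len addn1.
case: (x \notin _) => /=; rewrite ?addn0 ?addn2 => e.
  by case: e => <-; lia.
by rewrite e; lia.
Qed.

End PermLen.

Lemma perm_len1 (T : finType) : perm_len (1 : {perm T})%g = 0%N.
Proof.
rewrite (@perm_lenE _ _ (fun x => enum_rank x)); last exact: inj_comp val_inj enum_rank_inj.
apply: eq_card0 => x; rewrite !inE; apply/exists_inP => -[y].
by rewrite porbit_traject /= => /trajectP[i _ ->]; rewrite -permX expg1n perm1 ltnn.
Qed.

(** Outside the image of [f] every point is fixed, hence minimal in its cycle and not counted; on
    the image the count is the one for [s], with the ranking pulled back along [f]. *)
Lemma perm_len_transfer (T T' : finType) (f : T -> T') (s : {perm T})
    (s' : {perm T'}) : injective f -> (forall x, s' (f x) = f (s x)) ->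
  (forall y, y \notin codom f -> s' y = y) -> perm_len s' = perm_len s.
Proof.
move=> f_inj s's s'_id; pose r y : nat := @enum_rank T' y.
have r_inj : injective r by exact: inj_comp val_inj enum_rank_inj.
rewrite (perm_lenE _ r_inj) (perm_lenE _ (inj_comp r_inj f_inj)).
rewrite -(card_imset _ f_inj); apply: eq_card => y; rewrite !inE.
have iter_f i x : (s' ^+ i)%g (f x) = f ((s ^+ i)%g x).
  by rewrite !permX; elim: i => //= i ->.
apply/exists_inP/imsetP => [[z /porbitP[i ->{z}] lt_y]|[x + ->]].
  have [/codomP[x yx]|/s'_id y_id] := boolP (y \in codom f); last first.
    suff y_fix : (s' ^+ i)%g y = y by rewrite y_fix ltnn in lt_y.
    by rewrite permX; elim: i {lt_y} => //= i ->.
  exists x => //; rewrite inE; apply/exists_inP; exists ((s ^+ i)%g x).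
    exact: mem_porbit.
  by move: lt_y; rewrite yx iter_f.
rewrite inE => /exists_inP[_ /porbitP[i ->] lt_x].
by exists ((s' ^+ i)%g (f x)); rewrite ?mem_porbit // iter_f.
Qed.

(** * Colour preserving permutations and their restrictions to the colour classes *)

Section ColourClasses.
Variables (T I : finType) (c : T -> I).

Definition preserves (s : {perm T}) : bool := [forall x, c (s x) == c x].

Definition colour_class (i : I) : {set T} := [set x | c x == i]%SET.

Lemma preservesP (s : {perm T}) : reflect (forall x, c (s x) = c x) (preserves s).
Proof. by apply: (iffP fintype.forallP) => cs x; apply/eqP. Qed.

Lemma preserves_group_set : group_set [set s | preserves s]%SET.
Proof.
apply/group_setP; split=> [|s t]; rewrite !inE.
  by apply/preservesP => x; rewrite perm1.
by move=> /preservesP cs /preservesP ct; apply/preservesP=> x; rewrite permM ct.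
Qed.

Canonical preserves_group := Group preserves_group_set.

Lemma preservesM s t : preserves s -> preserves (s * t)%g = preserves t.
Proof.
by move=> cs; have := @groupMl _ preserves_group s t; rewrite !inE => ->.
Qed.

Lemma preservesMr s t : preserves t -> preserves (s * t)%g = preserves s.
Proof.
by move=> cs; have := @groupMr _ preserves_group t s; rewrite !inE => ->.
Qed.

Lemma preservesV s : preserves s^-1 = preserves s.
Proof. by have := @groupV _ preserves_group s; rewrite !inE. Qed.

Lemma preserves_astabs s i : preserves s -> s \in 'N(colour_class i | 'P)%g.
Proof. by move=> /preservesP cs; apply/astabsP => x; rewrite !inE /= apermE cs. Qed.

Definition restr (i : I) (s : {perm T}) := restr_perm (colour_class i) s.

Lemma restrE i s x : preserves s -> restr i s x = if c x == i then s x else x.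
Proof.
move=> cs; case: ifPn => xi.
  by rewrite /restr restr_permE //; [exact: preserves_astabs|rewrite inE].
by rewrite (out_perm (restr_perm_on _ _)) // inE.
Qed.

Lemma restrMV i s t : preserves s -> preserves t ->
  restr i (s^-1 * t)%g = ((restr i s)^-1 * restr i t)%g.
Proof.
move=> cs ct; have Ns := preserves_astabs i cs; have Nt := preserves_astabs i ct.
by rewrite /restr morphM ?groupV // morphV.
Qed.

(** Each cycle of [s] has a single colour. The non-minimal points of colour [i] are those of
    [restr i s], since the points of other colours are fixed by it. *)
Lemma perm_len_restr s : preserves s ->
  perm_len s = (\sum_i perm_len (restr i s))%N.
Proof.
move=> cs; pose r y : nat := @enum_rank T y.
have r_inj : injective r by exact: inj_comp val_inj enum_rank_inj.
rewrite (perm_lenE _ r_inj) -sum1_card (partition_big c predT) //=.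
apply: eq_bigr => i _; rewrite sum1_card (perm_lenE _ r_inj); apply: eq_card => x.
rewrite !inE unfold_in /= inE.
have c_iter j y : c y = i -> (restr i s ^+ j)%g y = (s ^+ j)%g y /\ c ((s ^+ j)%g y) = i.
  move=> cy; rewrite !permX; elim: j => //= j [-> IH].
  by rewrite restrE // IH eqxx (preservesP _ cs).
have [cx|cx] := eqVneq (c x) i.
  rewrite andbT; apply/exists_inP/exists_inP => -[_ /porbitP[j ->] lt_x];
    have [e _] := c_iter j x cx.
    by exists ((restr i s ^+ j)%g x); rewrite ?mem_porbit // e.
  by exists ((s ^+ j)%g x); rewrite ?mem_porbit // -e.
rewrite andbF; apply/esym/exists_inP => -[_ /porbitP[j ->]].
suff -> : (restr i s ^+ j)%g x = x by rewrite ltnn.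
by rewrite permX; elim: j => //= j ->; rewrite restrE // (negPf cx).
Qed.

End ColourClasses.

(** * Jucys-Murphy factors and monotone factorizations *)

Lemma big_tuple_cons (V : nmodType) (T : finType) L (F : L.+1.-tuple T -> V) :
  \sum_t F t = \sum_x \sum_(t : L.-tuple T) F [tuple of x :: t].
Proof.
rewrite pair_big /= (reindex (fun xt : T * L.-tuple T => [tuple of xt.1 :: xt.2])) //=.
exists (fun t : L.+1.-tuple T => (thead t, [tuple of behead t])) => [[x t] _|t _] /=.
  by congr (_, _); apply: val_inj.
by rewrite [RHS]tuple_eta.
Qed.

Section Monotone.
Variables (k : nat) (I : finType) (c : 'I_k -> I).
Implicit Types (ij : 'I_k * 'I_k) (s t : {perm 'I_k}) (n L : nat).

(** The lower bound [n] on the larger entries makes the notion recursive: the tail of a word is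
    monotone from the larger entry of its first letter on. *)
Definition monotone n (w : seq ('I_k * 'I_k)) : bool :=
  all (fun ij => [&& (ij.1 < ij.2)%N, c ij.1 == c ij.2 & (n <= ij.2)%N]) w
  && sorted (fun ij ij' => ij.2 <= ij'.2)%N w.

Lemma monotone_cons n ij w : monotone n (ij :: w) =
  [&& (ij.1 < ij.2)%N, c ij.1 == c ij.2, (n <= ij.2)%N & monotone ij.2 w].
Proof.
rewrite /monotone /= path_sortedE; last by move=> x y z; apply: leq_trans.
case: (ltnP ij.1 ij.2) => //= _; case: eqP => //= _.
case: leqP => //= le_n.
rewrite andbA; congr (_ && _); rewrite -all_predI; apply/eq_all => z /=.
case: (leqP ij.2 z.2) => le_z; rewrite ?andbF ?andbT /= ?andbF ?andbT //.
by rewrite (leq_trans le_n le_z) ?andbT.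
Qed.

(** Products of [perm] act from left to right, so the first letter is put last: this is the
    composition $(i_1\,j_1)\cdots(i_r\,j_r)$ of functions. *)
Definition word_perm (w : seq ('I_k * 'I_k)) : {perm 'I_k} :=
  foldr (fun ij s => s * tperm ij.1 ij.2)%g 1%g w.

Definition monotone_count n L s : nat :=
  (\sum_(w : L.-tuple ('I_k * 'I_k) | monotone n w) (word_perm w == s))%N.

Lemma monotone_count0 n s : monotone_count n 0 s = (s == 1%g).
Proof.
rewrite /monotone_count (big_pred1 [tuple]) /=; first by rewrite eq_sym.
by move=> w; rewrite (tuple0 w); apply/esym/eqP.
Qed.

Lemma monotone_countS n L s : monotone_count n L.+1 s =
  (\sum_(ij : 'I_k * 'I_k | [&& (ij.1 < ij.2), c ij.1 == c ij.2 & (n <= ij.2)])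
     monotone_count ij.2 L (s * tperm ij.1 ij.2)%g)%N.
Proof.
rewrite /monotone_count big_mkcond big_tuple_cons [RHS]big_mkcond /=.
apply: eq_bigr => ij _.
under eq_bigr do rewrite monotone_cons.
case: (ltnP ij.1 ij.2) => _ /=; last by rewrite big1.
case: eqP => _ /=; last by rewrite big1.
case: (leqP n ij.2) => _ /=; last by rewrite big1.
rewrite [RHS]big_mkcond; apply: eq_bigr => w _; case: ifP => // _; congr (nat_of_bool _).
by rewrite -[RHS](inj_eq (mulIg (tperm ij.1 ij.2))) -mulgA tperm2 mulg1.
Qed.

Lemma monotone_count_le n L s : (monotone_count n L s <= (k * k) ^ L)%N.
Proof.
rewrite -[X in (_ <= (X * X) ^ _)%N]card_ord -card_prod -card_tuple -sum1_card.
by rewrite /monotone_count big_mkcond; apply: leq_sum => w _; case: ifP => // _; apply: leq_b1.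
Qed.

(** The words are split according to whether the larger entry of the first letter is [j]. Removing
    such a letter leaves a word that is still monotone from [j] on. *)
Lemma monotone_count_ltn (j : 'I_k) L s : monotone_count j L.+1 s =
  (monotone_count j.+1 L.+1 s
   + \sum_(i : 'I_k | (i < j)%N && (c i == c j)) monotone_count j L (s * tperm i j)%g)%N.
Proof.
rewrite !monotone_countS (bigID (fun ij : 'I_k * 'I_k => ij.2 == j)) /= addnC.
congr (_ + _)%N.
  apply: eq_bigl => ij; rewrite -!andbA; do 2 congr (_ && _).
  by rewrite ltn_neqAle eq_sym andbC -(inj_eq val_inj).
rewrite (eq_bigl (fun ij : 'I_k * 'I_k =>
    ((ij.1 < j)%N && (c ij.1 == c j)) && (ij.2 == j))); last first.
  by move=> ij; have [->|_] := eqVneq ij.2 j; rewrite ?andbF ?leqnn ?andbT.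
rewrite -(pair_big_dep (fun i : 'I_k => (i < j)%N && (c i == c j)) (fun i i' : 'I_k => i' == j)
  (fun i i' : 'I_k => monotone_count i' L (s * tperm i i')%g)) /=.
by apply: eq_bigr => i _; rewrite big_pred1_eq.
Qed.

Lemma monotone_count_end L s : monotone_count k L.+1 s = 0%N.
Proof.
rewrite monotone_countS big_pred0 // => ij.
by rewrite [(k <= _)%N]leqNgt ltn_ord !andbF.
Qed.

End Monotone.

(** * The coloured Gram function and its inverse for convolution *)

Section Expansion.
Variables (R : realType) (k : nat) (I : finType) (c : 'I_k -> I) (y : R).
Implicit Types (i j : 'I_k) (s t u : {perm 'I_k}) (n L : nat).

Definition fixes n s : bool := [forall x : 'I_k, (n <= x)%N ==> (s x == x)].

Lemma fixesP n s : reflect (forall x : 'I_k, (n <= x)%N -> s x = x) (fixes n s).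
Proof.
apply: (iffP fintype.forallP) => fs x; first by move=> le_n; apply/eqP/(implyP (fs x)).
by apply/implyP => le_n; apply/eqP/fs.
Qed.

(** In the group algebra this is the partial product of the factors $1+yJ_j$ over $j<n$. *)
Definition gram n s : R :=
  if preserves c s && fixes n s then y ^+ perm_len s else 0.

Lemma gram0 s : gram 0 s = (s == 1%g)%:R.
Proof.
rewrite /gram; case: eqP => [->|neq_s].
  rewrite perm_len1 expr0 ifT //; apply/andP; split.
    by apply/preservesP => x; rewrite perm1.
  by apply/fixesP => x; rewrite perm1.
case: ifP => // /andP[_ /fixesP fs]; case: neq_s.
by apply/permP => x; rewrite fs ?perm1.
Qed.

Lemma preserves_tperm i j : c i = c j -> preserves c (tperm i j).
Proof. by move=> cij; apply/preservesP => x; case: tpermP => // ->. Qed.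

(* The Jucys-Murphy factorization, one factor at a time. *)
Lemma gramS j s : gram j.+1 s =
  gram j s + y * \sum_(i : 'I_k | (i < j)%N && (c i == c j)) gram j (s * tperm i j)%g.
Proof.
have pres (i : 'I_k) : c i = c j -> preserves c (s * tperm i j)%g = preserves c s.
  by move=> cij; rewrite preservesMr // preserves_tperm.
have [cs|Ncs] := boolP (preserves c s); last first.
  rewrite {1 2}/gram (negPf Ncs) /= big1 ?mulr0 ?addr0 // => i /andP[_ /eqP cij].
  by rewrite /gram pres // (negPf Ncs).
have [fs|Nfs] := boolP (fixes j.+1 s); last first.
  have Nfj (t : {perm 'I_k}) : (forall x : 'I_k, (j < x)%N -> t x = x -> s x = x) -> gram j t = 0.
    move=> ts; rewrite /gram ifN // negb_and; apply/orP; right.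
    apply: contra Nfs => /fixesP ft; apply/fixesP => x ltx.
    by apply: ts => //; apply/ft/ltnW.
  rewrite (Nfj s) // {1}/gram (negPf Nfs) andbF big1 ?mulr0 ?addr0 // => i /andP[lt_ij _].
  apply: Nfj => x lt_jx; rewrite permM; case: tpermP => // -> xE.
    by rewrite -xE ltnn in lt_jx.
  by rewrite -xE ltnNge ltnW in lt_jx.
have fj t : (t j == j) -> (forall x : 'I_k, (j < x)%N -> t x = x) -> fixes j t.
  move=> /eqP tj ft; apply/fixesP => x; rewrite leq_eqVlt => /orP[/eqP e|]; last exact: ft.
  by have <- : j = x by apply: val_inj.
move/fixesP in fs.
(* If [s] fixes [j], each [s * tperm i j] moves [j], and only the first term remains. Otherwise only
   [i = s j] contributes: this transposition cuts [j] off its cycle, lowers the length by one, and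
   so accounts for the factor [y]. *)
have [sj|sj] := eqVneq (s j) j.
  rewrite big1 ?mulr0 ?addr0.
    have fjs : fixes j s by apply: fj; [rewrite sj|exact: fs].
    by rewrite /gram cs fjs /= ifT //; apply/fixesP.
  move=> i /andP[lt_ij _]; rewrite /gram [fixes _ _]negbTE ?andbF //.
  apply/negP => /fixesP/(_ j (leqnn _)); rewrite permM sj tpermR => ij.
  by rewrite ij ltnn in lt_ij.
have lt_sj : (s j < j)%N.
  rewrite ltn_neqAle; apply/andP; split.
    by apply: contra sj => /eqP /val_inj ->.
  rewrite leqNgt; apply/negP => /fs /perm_inj e; by rewrite e eqxx in sj.
have lenE : perm_len s = (perm_len (s * tperm (s j) j)%g).+1.
  rewrite -perm_lenV -[in RHS]perm_lenV invMg tpermV; apply: perm_len_tperm => //.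
  by rewrite porbitV -[X in X \in _]/((s ^+ 1)%g j) mem_porbit.
rewrite {2}/gram [fixes j s]negbTE ?andbF ?add0r; last first.
  by apply/negP => /fixesP/(_ j (leqnn _))/eqP; apply/negP.
rewrite (bigD1 (s j)) /=; last by rewrite lt_sj (preservesP _ _ cs) eqxx.
rewrite big1 ?addr0; last first.
  move=> i /andP[/andP[lt_ij _] neq_i]; rewrite /gram [fixes _ _]negbTE ?andbF //.
  apply/negP => /fixesP/(_ j (leqnn _)); rewrite permM.
  case: tpermP => [e|e|_ //]; first by rewrite e eqxx in neq_i.
  by move=> _; rewrite e eqxx in sj.
rewrite /gram cs pres ?(preservesP _ _ cs) // cs /=.
rewrite ifT; last by apply/fixesP.
rewrite ifT ?lenE ?exprS //; apply: fj; first by rewrite permM tpermL.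
move=> x lt_jx; rewrite permM (fs x lt_jx); apply: tpermD; apply/negP => /eqP e.
  by rewrite -e ltnNge ltnW in lt_jx.
by rewrite e ltnn in lt_jx.
Qed.

(** The signs come from the geometric series $(1+yJ_j)^{-1}=\sum_L(-y)^LJ_j^L$; the whole series is
    the product of these inverses over $j\ge n$. *)
Definition monotone_coef n s L : R := (- y) ^+ L * (monotone_count c n L s)%:R.

Definition monotone_series n s : R := limn (series (monotone_coef n s)).

Hypothesis small_y : `|y| * (k * k)%:R < 1.

(** Comparison with the geometric series of ratio $|y|k^2$; the assumed bound is the trivial one on
    the number of words of length [L]. *)
Lemma is_cvg_series_bounded (u : nat -> nat) : (forall L, (u L <= (k * k) ^ L)%N) ->
  cvgn (series (fun L => (- y) ^+ L * (u L)%:R : R)).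
Proof.
move=> u_le; apply: normed_cvg.
apply: (@series_le_cvg R _ (geometric 1 (`|y| * (k * k)%:R))) => //.
- by move=> L; apply: normr_ge0.
- by move=> L; rewrite /= mul1r exprn_ge0 // mulr_ge0.
- move=> L; rewrite /= mul1r exprMn normrM normrX normrN normr_nat.
  by rewrite ler_wpM2l ?exprn_ge0 // -natrX ler_nat.
by apply: is_cvg_geometric_series; rewrite ger0_norm // mulr_ge0.
Qed.

Lemma cvg_monotone_series n s :
  (series (monotone_coef n s) @ \oo --> monotone_series n s)%classic.
Proof. by apply: is_cvg_series_bounded => L; apply: monotone_count_le. Qed.

(** Multiplying by $1+yJ_j$ cancels the inverse of that factor. Coefficientwise this is
    [monotone_count_ltn]. *)
Lemma monotone_seriesS j s : monotone_series j.+1 s =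
  monotone_series j s + y * \sum_(i : 'I_k | (i < j)%N && (c i == c j))
     monotone_series j (s * tperm i j)%g.
Proof.
(* The sum over [i] stops one term earlier because its words have lost a letter, which the factor
   [y] replaces. *)
have partial N : series (monotone_coef j.+1 s) N.+1 = series (monotone_coef j s) N.+1
    + y * \sum_(i : 'I_k | (i < j)%N && (c i == c j))
        series (monotone_coef j (s * tperm i j)%g) N.
  rewrite /series /= !big_nat_recl // /monotone_coef !monotone_count0 -!addrA.
  congr (_ + _); rewrite exchange_big /= mulr_sumr -big_split /=.
  apply: eq_bigr => L _; rewrite monotone_count_ltn.
  move: (monotone_count c j.+1 L.+1 s) => a; rewrite natrD natr_sum -mulr_sumr exprS.
  by ring.
have cvgL : (series (monotone_coef j.+1 s) N.+1 @[N --> \oo] --> monotone_series j.+1 s)%classic.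
  by have := cvg_monotone_series (n := j.+1) (s := s); rewrite -cvg_shiftS.
suff cvgR : (series (monotone_coef j.+1 s) N.+1 @[N --> \oo] --> monotone_series j s +
    y * \sum_(i : 'I_k | (i < j)%N && (c i == c j))
      monotone_series j (s * tperm i j)%g)%classic.
  exact: (cvg_unique _ cvgL cvgR).
rewrite (funext partial); apply: cvgD.
  by have := cvg_monotone_series (n := j) (s := s); rewrite -cvg_shiftS.
apply: cvgMl_tmp; apply: cvg_big => [|i _]; first exact: add_continuous.
exact: cvg_monotone_series.
Qed.

Lemma monotone_series_end s : monotone_series k s = (s == 1%g)%:R.
Proof.
apply/cvg_lim => //; rewrite -cvg_shiftS.
rewrite (_ : (fun N => _) = fun=> (s == 1%g)%:R); first exact: cvg_cst.
apply/funext => N; rewrite /series /= big_nat_recl // big1 ?addr0.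
  by rewrite /monotone_coef monotone_count0 expr0 mul1r.
by move=> L _; rewrite /monotone_coef monotone_count_end mulr0.
Qed.

(** By induction on [n]: each new factor of [gram] cancels one inverse factor of the series. At
    [n = k] nothing is left, so the full series is a left inverse of the Gram function. *)
Lemma monotone_series_gram n t : (n <= k)%N ->
  \sum_u monotone_series 0 u * gram n (u^-1 * t)%g = monotone_series n t.
Proof.
elim: n t => [|n IHn] t le_n.
  rewrite (bigD1 t) //= gram0 mulVg eqxx mulr1 big1 ?addr0 // => u neq_u.
  rewrite gram0; case: eqP => [e|]; rewrite ?mulr0 //.
  by case/eqP: neq_u; rewrite -[u]mulg1 -e mulgA mulgV mul1g.
rewrite (monotone_seriesS (Ordinal le_n)) /= -(IHn t (ltnW le_n)).
under [in RHS]eq_bigr do rewrite -IHn ?(ltnW le_n) //.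
rewrite exchange_big /= mulr_sumr -big_split /=; apply: eq_bigr => u _.
rewrite (gramS (Ordinal le_n)) /= mulrDr; congr (_ + _).
rewrite mulrCA; congr (_ * _); rewrite mulr_sumr; apply: eq_bigr => i _.
by rewrite mulgA.
Qed.

Definition colour_gram s : R := if preserves c s then y ^+ perm_len s else 0.

(** [W] is a right inverse and the series a left inverse of the same function, so they agree by
    associativity of convolution. *)
Lemma gram_inverse_expansion (W : {perm 'I_k} -> R) :
  (forall t, \sum_u colour_gram u * W (u^-1 * t)%g = (t == 1%g)%:R) ->
  forall s, W s = monotone_series 0 s.
Proof.
move=> GW s.
have gramE u : gram k u = colour_gram u.
  rewrite /gram /colour_gram; case: preserves => //=; rewrite ifT //.
  by apply/fixesP => x; rewrite leqNgt ltn_ord.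
have SG t : \sum_u monotone_series 0 u * colour_gram (u^-1 * t)%g = (t == 1%g)%:R.
  by rewrite -monotone_series_end -monotone_series_gram //; apply: eq_bigr => u _; rewrite gramE.
(* This triple convolution is [W s] when summed over [u] first, and the series when summed over [v]
   first. *)
transitivity (\sum_v \sum_u monotone_series 0 u * colour_gram (u^-1 * v)%g * W (v^-1 * s)%g).
  under eq_bigr do rewrite -mulr_suml SG.
  rewrite (bigD1 1%g) //= eqxx mul1r invg1 mul1g big1 ?addr0 // => v /negPf ->.
  by rewrite mul0r.
rewrite exchange_big /= (bigD1 s) //= [X in _ + X]big1 ?addr0 => [|u neq_us].
  under eq_bigr do rewrite -mulrA.
  rewrite -mulr_sumr (reindex_inj (mulgI s)) /=.
  under eq_bigr do rewrite mulKg invMg -mulgA.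
  rewrite (eq_bigr (fun v => colour_gram v * W (v^-1 * 1)%g)).
    by rewrite GW eqxx mulr1.
  by move=> v _; rewrite mulVg.
under eq_bigr do rewrite -mulrA.
rewrite -mulr_sumr (reindex_inj (mulgI u)) /=.
under eq_bigr do rewrite mulKg invMg -mulgA.
rewrite GW; case: eqP => [e|]; rewrite ?mulr0 //.
by case/eqP: neq_us; rewrite -[u]mulg1 -e mulgA mulgV mul1g.
Qed.

End Expansion.

(** * Products over colour classes *)

Section Transport.
Variables (R : comPzRingType) (y : R) (m : nat) (T : finType) (f : 'I_m -> T).
Variables (E : {set T}) (pull : {perm T} -> 'S_m).
Hypotheses (f_inj : injective f) (f_im : forall z, (z \in codom f) = (z \in E)).
Hypothesis pullP : forall u, perm_on E u -> forall i, u (f i) = f (pull u i).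

Definition push_fun (w : 'S_m) z : T := if [pick i | f i == z] is Some i then f (w i) else z.

Lemma push_funE w i : push_fun w (f i) = f (w i).
Proof.
rewrite /push_fun; case: pickP => [j /eqP/f_inj ->|/(_ i)] //.
by rewrite eqxx.
Qed.

Lemma push_fun_out w z : z \notin E -> push_fun w z = z.
Proof.
rewrite -f_im /push_fun; case: pickP => // i /eqP <-.
by rewrite codom_f.
Qed.

Lemma push_fun_inj w : injective (push_fun w).
Proof.
apply: (can_inj (g := push_fun w^-1)) => z.
have [|zE] := boolP (z \in E); last by rewrite !push_fun_out.
by rewrite -f_im => /codomP[i ->]; rewrite !push_funE permK.
Qed.

Definition push w : {perm T} := perm (push_fun_inj (w := w)).

Lemma push_on w : perm_on E (push w).
Proof.
apply/fintype.subsetP => z; rewrite inE; apply: contraNT => zE.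
by rewrite permE push_fun_out.
Qed.

Lemma pushK : cancel push pull.
Proof.
move=> w; apply/permP => i; apply: f_inj.
by rewrite -(pullP (push_on w)) permE push_funE.
Qed.

Lemma pullK u : perm_on E u -> push (pull u) = u.
Proof.
move=> uE; apply/permP => z; rewrite permE.
have [|zE] := boolP (z \in E); last by rewrite push_fun_out // (out_perm uE).
by rewrite -f_im => /codomP[i ->]; rewrite push_funE pullP.
Qed.

Lemma pullMV u t : perm_on E u -> perm_on E t ->
  pull (u^-1 * t)%g = ((pull u)^-1 * pull t)%g.
Proof.
move=> uE tE; have vE := perm_onV uE; apply/permP => i; apply: f_inj.
rewrite -pullP; last exact: perm_onM.
rewrite !permM; set j := ((pull u)^-1 i)%g.
have -> : (u^-1 (f i) = f j)%g by apply: (perm_inj (s := u)); rewrite permKV pullP // permKV.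
by rewrite pullP.
Qed.

Lemma perm_len_pull u : perm_on E u -> perm_len u = perm_len (pull u).
Proof.
move=> uE; apply: (perm_len_transfer f_inj) => [i|z]; first exact: pullP.
by rewrite f_im; apply: out_perm.
Qed.

(** [push] and [pull] are inverse bijections between ['S_m] and the permutations supported on [E];
    they respect the quotients [u^-1 * t] and the length. *)
Lemma gram_inverse_pull (V : 'S_m -> R) :
  (forall t, \sum_u y ^+ perm_len u * V (u^-1 * t)%g = (t == 1%g)%:R) ->
  forall t, perm_on E t ->
    \sum_(u | perm_on E u) y ^+ perm_len u * V (pull (u^-1 * t)%g) = (t == 1%g)%:R.
Proof.
move=> GV t tE; have pull1 : (pull t == 1%g) = (t == 1%g).
  apply/eqP/eqP => [e|->]; last first.
    have := pullMV (perm_on1 E) (perm_on1 E).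
    by rewrite mulVg => ->; rewrite mulVg.
  apply/permP => z; rewrite perm1; have [|zE] := boolP (z \in E); last exact: out_perm tE _.
  by rewrite -f_im => /codomP[i ->]; rewrite pullP // e perm1.
rewrite -pull1 -GV (reindex push) /=; last first.
  by exists pull => u; rewrite ?pushK // => /pullK.
apply: eq_big => [w|w _]; first exact: push_on.
by rewrite pullMV ?push_on // perm_len_pull ?push_on // pushK.
Qed.

End Transport.

Section ColourProduct.
Variables (R : comPzRingType) (y : R) (T I : finType) (c : T -> I).
Variable V : I -> {perm T} -> R.
Hypothesis GV : forall i t, perm_on (colour_class c i) t ->
  \sum_(u | perm_on (colour_class c i) u) y ^+ perm_len u * V i (u^-1 * t)%g = (t == 1%g)%:R.

Definition glue_fun (g : {ffun I -> {perm T}}) x : T := g (c x) x.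

Lemma perm_on_colour_class i (s : {perm T}) x :
  perm_on (colour_class c i) s -> c x = i -> c (s x) = i.
Proof.
by move=> si cx; have := perm_closed x si; rewrite !inE cx eqxx => /eqP.
Qed.

(** The default value 1 does not occur once each [g i] is supported on its colour class, for then
    [glue_fun g] is injective. *)
Definition glue (g : {ffun I -> {perm T}}) : {perm T} :=
  insubd (1%g : {perm T}) [ffun x => glue_fun g x].

Lemma glueE (g : {ffun I -> {perm T}}) x :
  (forall i, perm_on (colour_class c i) (g i)) -> glue g x = g (c x) x.
Proof.
move=> gP; rewrite -pvalE (_ : pval (glue g) = [ffun z => glue_fun g z]) ?ffunE //.
apply: (insubdK (1%g : {perm T})); apply/injectiveP => x1 x2; rewrite !ffunE /glue_fun => e.
have c12 : c x1 = c x2.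
  by rewrite -(perm_on_colour_class (gP (c x1)) (erefl _)) e (perm_on_colour_class (gP (c x2))).
by move: e; rewrite c12 => /perm_inj.
Qed.

(** The colour preserving permutations form the direct product of the symmetric groups of the
    classes, and the length is additive, so the sum factors into one relation [GV] per colour. *)
Lemma gram_inverse_product t :
  \sum_u (if preserves c u then y ^+ perm_len u else 0) *
    (if preserves c (u^-1 * t)%g then \prod_i V i (restr c i (u^-1 * t)%g) else 0)
  = (t == 1%g)%:R.
Proof.
have [ct|Nct] := boolP (preserves c t); last first.
  rewrite big1.
    by case: eqP Nct => // ->; rewrite (_ : preserves c 1) //; apply/preservesP => x; rewrite perm1.
  move=> u _; case: ifP => cu; rewrite ?mul0r // preservesM ?preservesV //.
  by rewrite (negPf Nct) mulr0.
transitivity (\prod_i \sum_(u | perm_on (colour_class c i) u)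
    y ^+ perm_len u * V i (u^-1 * restr c i t)%g); last first.
  under eq_bigr => i _ do rewrite GV ?restr_perm_on //.
  have [->|neq_t] := eqVneq t 1%g.
    rewrite big1 // => i _; rewrite (_ : restr c i 1 = 1%g) ?eqxx //.
    exact: morph1.
  suff [x tx] : exists x, t x != x.
    rewrite (bigD1 (c x)) //= (_ : _ == _ = false) ?mul0r //.
    apply/negP => /eqP/permP/(_ x); rewrite restrE // eqxx perm1.
    by apply/eqP.
  apply/existsP; apply: contraR neq_t; rewrite negb_exists => /fintype.forallP tx.
  by apply/eqP/permP => x; rewrite perm1; apply/eqP; rewrite -[_ == _]negbK.
(* Families of permutations, one on each class, correspond to colour preserving permutations through
   restriction and gluing. *)
rewrite bigA_distr_big_dep big_mkcond /= [RHS](reindex_onto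
  (fun u => [ffun i => restr c i u]) glue) /=; last first.
  move=> g /familyP gP.
  have {}gP i : perm_on (colour_class c i) (g i) by have := gP i; rewrite unfold_in.
  have pg : preserves c (glue g).
    by apply/preservesP => x; rewrite glueE //; apply: perm_on_colour_class (gP _) _.
  apply/ffunP => i; apply/permP => x; rewrite ffunE restrE // glueE //.
  by case: eqP => [-> //|/eqP cx]; rewrite (out_perm (gP i)) // inE.
rewrite [RHS]big_mkcond; apply: eq_bigr => u _.
have gP : [ffun i => restr c i u] \in family (fun i => perm_on (colour_class c i)).
  by apply/familyP => i; rewrite ffunE; apply: restr_perm_on.
(* If [u] does not preserve colours, both terms vanish: gluing its restrictions gives a colour
   preserving permutation, hence not [u]. *)
rewrite gP /=; case: ifPn => cu; last first.
  rewrite mul0r; case: eqP => // e.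
  have gP' i : perm_on (colour_class c i) ([ffun i => restr c i u] i).
    by rewrite ffunE restr_perm_on.
  case/negP: cu; apply/preservesP => x; rewrite -e glueE //.
  exact: perm_on_colour_class (gP' _) _.
rewrite ifT; last by rewrite preservesM ?preservesV.
rewrite ifT; last first.
  apply/eqP/permP => x; rewrite glueE => [|i]; last by rewrite ffunE restr_perm_on.
  by rewrite ffunE restrE // eqxx.
rewrite (perm_len_restr cu) expr_sum -big_split /=.
by apply: eq_bigr => i _; rewrite ffunE restrMV.
Qed.

End ColourProduct.

(** * Integration over the unitary group *)

Section HaarIntegrals.
Variables (R : realType) (n : nat) (mu : probability (unitary_borel R n) R).
Implicit Types (f g : unitary_borel R n -> R) (F G : unitary_borel R n -> R[i]).

(** This class is closed under sums and products and consists of integrable functions, which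
    suffices for polynomials in the entries and their conjugates. *)
Definition bounded_measurable f : Prop :=
  measurable_fun [set: unitary_borel R n]%classic f /\ exists M, forall U, `|f U| <= M.

Lemma bounded_measurable_cst a : bounded_measurable (fun=> a).
Proof. by split; [exact: measurable_cst|exists `|a|]. Qed.

Lemma bounded_measurableD f g :
  bounded_measurable f -> bounded_measurable g -> bounded_measurable (f \+ g).
Proof.
move=> [mf [M fM]] [mg [N gN]]; split; first exact: measurable_funD.
by exists (M + N) => U; rewrite (le_trans (ler_normD _ _)) // lerD.
Qed.

Lemma bounded_measurableM f g :
  bounded_measurable f -> bounded_measurable g -> bounded_measurable (f \* g).
Proof.
move=> [mf [M fM]] [mg [N gN]]; split; first exact: measurable_funM.
by exists (M * N) => U; rewrite /= normrM ler_pM.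
Qed.

Lemma bounded_measurableN f : bounded_measurable f -> bounded_measurable (\- f).
Proof.
move=> bf; have := bounded_measurableM (bounded_measurable_cst (-1)) bf.
by congr bounded_measurable; apply/funext => U /=; rewrite mulN1r.
Qed.

Lemma bounded_measurable_integrable f : bounded_measurable f ->
  mu.-integrable [set: unitary_borel R n]%classic (EFin \o f).
Proof.
move=> [mf [M fM]]; apply: measurable_bounded_integrable => //.
  by apply: (le_lt_trans (probability_le1 mu measurableT)); exact: ltry.
exists M; split; first exact: num_real.
by move=> x Mx U _; apply: le_trans (ltW Mx).
Qed.

Definition bounded_measurableC F : Prop :=
  bounded_measurable (fun U => complex.Re (F U)) /\
  bounded_measurable (fun U => complex.Im (F U)).

Lemma bounded_measurableC_cst a : bounded_measurableC (fun=> a).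
Proof. by split; apply: bounded_measurable_cst. Qed.

Lemma bounded_measurableCD F G : bounded_measurableC F -> bounded_measurableC G ->
  bounded_measurableC (fun U => F U + G U).
Proof.
move=> [Fr Fi] [Gr Gi]; split.
  rewrite (_ : (fun U => _) = (fun U => complex.Re (F U)) \+ (fun U => complex.Re (G U))).
    exact: bounded_measurableD.
  by apply/funext => U /=; case: (F U) (G U) => [? ?] [].
rewrite (_ : (fun U => _) = (fun U => complex.Im (F U)) \+ (fun U => complex.Im (G U))).
  exact: bounded_measurableD.
by apply/funext => U /=; case: (F U) (G U) => [? ?] [].
Qed.

Lemma bounded_measurableCM F G : bounded_measurableC F -> bounded_measurableC G ->
  bounded_measurableC (fun U => F U * G U).
Proof.
move=> [Fr Fi] [Gr Gi]; split.
  rewrite (_ : (fun U => _) =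
    ((fun U => complex.Re (F U)) \* (fun U => complex.Re (G U))) \+
    (\- ((fun U => complex.Im (F U)) \* (fun U => complex.Im (G U))))).
    by apply: bounded_measurableD; [|apply: bounded_measurableN];
      apply: bounded_measurableM.
  by apply/funext => U /=; case: (F U) (G U) => [? ?] [].
rewrite (_ : (fun U => _) =
  ((fun U => complex.Re (F U)) \* (fun U => complex.Im (G U))) \+
  ((fun U => complex.Im (F U)) \* (fun U => complex.Re (G U)))).
  by apply: bounded_measurableD; apply: bounded_measurableM.
by apply/funext => U /=; case: (F U) (G U) => [? ?] [].
Qed.

Lemma bounded_measurableC_conj F : bounded_measurableC F ->
  bounded_measurableC (fun U => (F U)^*).
Proof.
move=> [Fr Fi]; split.
  rewrite (_ : (fun U => _) = (fun U => complex.Re (F U))) //.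
  by apply/funext => U /=; case: (F U).
rewrite (_ : (fun U => _) = \- (fun U => complex.Im (F U))).
  exact: bounded_measurableN.
by apply/funext => U /=; case: (F U).
Qed.

Lemma bounded_measurableC_prod (J : Type) (r : seq J) (F : J -> unitary_borel R n -> R[i]) :
  (forall j, bounded_measurableC (F j)) ->
  bounded_measurableC (fun U => \prod_(j <- r) F j U).
Proof.
move=> bF; elim: r => [|j r IHr].
  by under eq_fun do rewrite big_nil; apply: bounded_measurableC_cst.
by under eq_fun do rewrite big_cons; apply: bounded_measurableCM.
Qed.

Lemma bounded_measurableC_sum (J : Type) (r : seq J) (F : J -> unitary_borel R n -> R[i]) :
  (forall j, bounded_measurableC (F j)) ->
  bounded_measurableC (fun U => \sum_(j <- r) F j U).
Proof.
move=> bF; elim: r => [|j r IHr].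
  by under eq_fun do rewrite big_nil; apply: bounded_measurableC_cst.
by under eq_fun do rewrite big_cons; apply: bounded_measurableCD.
Qed.

Lemma unitary_row (U : unitary_group R n) i i' :
  \sum_j unitary_mx U i j * (unitary_mx U i' j)^* = (i == i')%:R.
Proof.
have /unitarymxP/matrixP/(_ i i') := valP U.
rewrite !mxE => <-; apply: eq_bigr => j _.
by rewrite !mxE.
Qed.

Lemma unitary_entry_le (U : unitary_group R n) i j : `|unitary_mx U i j| <= 1.
Proof.
rewrite -(@expr_le1 _ 2) // normCK.
have := unitary_row U i i; rewrite eqxx (bigD1 j) //= => h; rewrite -[leRHS]h.
by rewrite lerDl sumr_ge0 // => l _; apply: mul_conjC_ge0.
Qed.

Lemma bounded_measurable_entry i j :
  bounded_measurableC (fun U => unitary_mx (U : unitary_group R n) i j).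
Proof.
have bnd (z : R[i]) : `|z| <= 1 -> `|complex.Re z| <= 1 /\ `|complex.Im z| <= 1.
  case: z => a b; rewrite normc_def /= lecR => ab.
  have ab1 : a ^+ 2 + b ^+ 2 <= 1.
    rewrite -[X in X <= _]sqr_sqrtr ?addr_ge0 ?sqr_ge0 //.
    by rewrite expr_le1 // sqrtr_ge0.
  rewrite -(@expr_le1 _ 2) // -[in X in _ /\ X](@expr_le1 _ 2) // !real_normK ?num_real //.
  by have := sqr_ge0 a; have := sqr_ge0 b; split; lra.
split; split.
- move=> _ A mA; rewrite setTI; apply: sub_sigma_algebra; exists i, j, A; split => //.
  by left.
- by exists 1 => U; have [] := bnd _ (unitary_entry_le U i j).
- move=> _ A mA; rewrite setTI; apply: sub_sigma_algebra; exists i, j, A; split => //.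
  by right.
- by exists 1 => U; have [] := bnd _ (unitary_entry_le U i j).
Qed.

Lemma unitary_expect_sum (J : Type) (r : seq J) (F : J -> 'M[R[i]]_n -> R[i]) :
  (forall j, bounded_measurableC (fun U => F j (unitary_mx (U : unitary_group R n)))) ->
  unitary_expect mu (fun U => \sum_(j <- r) F j U) = \sum_(j <- r) unitary_expect mu (F j).
Proof.
move=> bF; elim: r => [|j r IHr].
  rewrite big_nil /unitary_expect; under eq_Rintegral do rewrite big_nil.
  rewrite (Rintegral_cst mu measurableT) mul0r.
  under eq_Rintegral do rewrite big_nil.
  by rewrite (Rintegral_cst mu measurableT) mul0r.
rewrite big_cons -IHr; have [br bi] := bounded_measurableC_sum r bF.
have [bjr bji] := bF j.
rewrite /unitary_expect -[RHS]/(Complex (_ + _) (_ + _)).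
rewrite -!RintegralD //; try exact: bounded_measurable_integrable.
congr Complex; apply: eq_Rintegral => U _; rewrite big_cons.
  by case: (F j _) (\sum_(_ <- _) _) => [? ?] [].
by case: (F j _) (\sum_(_ <- _) _) => [? ?] [].
Qed.

Lemma unitary_expect_cst (a : R[i]) (F : 'M[R[i]]_n -> R[i]) :
  (forall U : unitary_group R n, F (unitary_mx U) = a) -> unitary_expect mu F = a.
Proof.
move=> FE; rewrite /unitary_expect.
under eq_Rintegral do rewrite FE.
rewrite (Rintegral_cst mu measurableT) [X in fine X](probability_setT mu) mulr1.
under eq_Rintegral do rewrite FE.
by rewrite (Rintegral_cst mu measurableT) [X in fine X](probability_setT mu) mulr1; case: a {FE}.
Qed.

End HaarIntegrals.

(** Such a [g] is constant on the cycles of [q], so it is a function on the set of cycles. This is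
    how the powers of $n$ arise from sums over column indices. *)
Lemma card_fixed_functions (T : finType) (n : nat) (q : {perm T}) :
  #|[set g : {ffun T -> 'I_n} | [forall l, g l == g (q l)]]%SET| = (n ^ #|porbits q|)%N.
Proof.
have orbP l : porbit q l \in porbits q by apply: imset_f.
pose orb l : {B | B \in porbits q} := exist (fun B => B \in porbits q) _ (orbP l).
pose lift (h : {ffun {B | B \in porbits q} -> 'I_n}) := [ffun l => h (orb l)].
have lift_inj : injective lift.
  move=> h1 h2 /ffunP e; apply/ffunP => -[B BP]; have /imsetP[l _ lB] := BP.
  have := e l; rewrite !ffunE (_ : orb l = exist _ B BP) //.
  exact: val_inj.
transitivity #|lift @: [set: {ffun {B | B \in porbits q} -> 'I_n}]|.
  apply: eq_card => g; rewrite inE; apply/fintype.forallP/imsetP => [ginv|[h _ ->] l].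
    have gorb l l' : l' \in porbit q l -> g l' = g l.
      move=> /porbitP[i ->]; elim: i => [|i IHi]; first by rewrite perm1.
      by rewrite expgSr permM -IHi; apply/esym/eqP.
    have rep (B : {B | B \in porbits q}) : {l | val B = porbit q l}.
      by apply: sig_eqW; have [l _] := imsetP (valP B); exists l.
    exists [ffun B => g (sval (rep B))]; first by rewrite inE.
    apply/ffunP => l; rewrite !ffunE /=; case: (rep _) => l' /= e.
    by apply/esym/gorb; rewrite e porbit_id.
  rewrite !ffunE; apply/eqP; congr (h _); apply: val_inj => /=.
  by apply/eqP; rewrite eq_porbit_mem porbit_sym (mem_porbit q 1).
by rewrite card_imset // cardsT card_ffun card_ord card_sig.
Qed.

(** * The Weingarten function as a convolution inverse *)

Section WeingartenRelation.
Variables (R : realType) (m n : nat) (mu : probability (unitary_borel R n) R).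
Variable W : 'S_m -> R.
Hypotheses (WP : is_weingarten mu W) (le_mn : (m <= n)%N).

(* Row orthogonality: put y = y' in the integration formula and sum over y. *)
Lemma weingarten_relation (t : 'S_m) :
  \sum_u n%:R ^+ #|porbits u| * W (u^-1 * t)%g = (t == 1%g)%:R.
Proof.
pose x (l : 'I_m) : 'I_n := widen_ord le_mn l.
have x_inj : injective x by move=> l l' /(congr1 val) /= /val_inj.
(* As [x] is injective, the condition [x l = x' (p l)] for all [l] holds for [p = t] only. *)
pose x' l := x (t^-1 l)%g.
pose F (g : {ffun 'I_m -> 'I_n}) (U : 'M[R[i]]_n) : R[i] :=
  \prod_(l < m) (U (x l) (g l) * (U (x' l) (g l))^*).
have EF : unitary_expect mu (fun U => \sum_g F g U) = (t == 1%g)%:R.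
  apply: unitary_expect_cst => U.
  (* The sum over [g] factors into scalar products of the rows [x l] and [x' l], so the integrand is
     constant. *)
  rewrite -(bigA_distr_bigA (fun l j => unitary_mx U (x l) j * (unitary_mx U (x' l) j)^*)) /=.
  under eq_bigr do rewrite unitary_row.
  have [t1|neq_t] := eqVneq t 1%g.
    by apply: big1 => l _; rewrite /x' t1 invg1 perm1 eqxx.
  have [l tl] : exists l, (t^-1 l)%g != l.
    apply/existsP; apply: contraR neq_t; rewrite negb_exists => /fintype.forallP tl.
    rewrite -eq_invg1; apply/eqP/permP => l; rewrite perm1; apply/eqP.
    by rewrite -[_ == _]negbK.
  rewrite (bigD1 l) //= /x' (inj_eq x_inj) eq_sym (negPf tl) mul0r //.
rewrite unitary_expect_sum in EF; last first.
  move=> g; apply: bounded_measurableC_prod => l; apply: bounded_measurableCM.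
    exact: bounded_measurable_entry.
  exact/bounded_measurableC_conj/bounded_measurable_entry.
apply: (@complexI R); rewrite rmorph_nat -EF.
have inner (g : {ffun 'I_m -> 'I_n}) :
    \sum_(p : 'S_m) \sum_(q : 'S_m) \prod_(l < m) (x l == x' (p l))%:R
      * \prod_(l < m) (g l == g (q l))%:R
      * W (q^-1 * p)%g
    = \sum_(q : 'S_m) \prod_(l < m) (g l == g (q l))%:R * W (q^-1 * t)%g.
  rewrite (bigD1 t) //= [X in _ + X]big1 ?addr0 => [|p neq_pt].
    apply: eq_bigr => q _; rewrite [X in X * _ * _]big1 ?mul1r // => l _.
    by rewrite /x' permK eqxx.
  apply: big1 => q _; suff -> : \prod_(l < m) (x l == x' (p l))%:R = 0 :> R by rewrite !mul0r.
  have [l pl] : exists l, p l != t l.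
    apply/existsP; apply: contraR neq_pt; rewrite negb_exists => /fintype.forallP pl.
    by apply/eqP/permP => l; apply/eqP; rewrite -[_ == _]negbK.
  rewrite (bigD1 l) //= /x' (inj_eq x_inj) eq_sym -(inj_eq (@perm_inj _ t)) permKV.
  by rewrite (negPf pl) mul0r.
under [in RHS]eq_bigr => g _ do rewrite /F (WP.2 x g x' g) inner.
rewrite -rmorph_sum /=; congr (_%:C)%C; rewrite exchange_big /=; apply: eq_bigr => q _.
rewrite -mulr_suml; congr (_ * _); rewrite -natrX -card_fixed_functions -sum1_card natr_sum.
rewrite big_mkcond /=; apply: eq_bigr => g _; rewrite inE; case: ifPn => [/fintype.forallP gq|].
  by rewrite big1 // => l _; rewrite (eqP (gq l)) eqxx.
rewrite negb_forall => /existsP[l gl]; by rewrite (bigD1 l) //= (negPf gl) mul0r.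
Qed.

End WeingartenRelation.

(** * Rational functions *)

Section RationalWeingarten.
Variables (R : fieldType) (m : nat).
Local Notation N := #|{: 'S_m}|.

Definition gram_mx : 'M[{poly R}]_N :=
  \matrix_(i, j) 'X^#|porbits ((enum_val i)^-1 * enum_val j)%g|.

(** The inverse of a convolution matrix has entries $W(a^{-1}b)$; the entry with $a=s^{-1}$ and
    $b=1$ gives the value at [s]. *)
Definition wg_num (s : 'S_m) : {poly R} :=
  (\adj gram_mx) (enum_rank s^-1%g) (enum_rank 1%g).

Definition wg_den : {poly R} := \det gram_mx.

Definition wg_rat (x : R) (s : 'S_m) : R := (wg_num s).[x] / wg_den.[x].

Lemma wg_rat_inverse x t : wg_den.[x] != 0 ->
  \sum_u x ^+ #|porbits u| * wg_rat x (u^-1 * t)%g = (t == 1%g)%:R.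
Proof.
move=> den0; have := mul_mx_adj gram_mx.
move/matrixP/(_ (enum_rank t^-1%g) (enum_rank 1%g))/(congr1 (horner_eval x)).
rewrite !mxE /horner_eval horner_sum -/wg_den (inj_eq enum_rank_inj) invg_eq1.
rewrite hornerMn -mulr_natr => e; apply: (mulfI den0); rewrite -e mulr_sumr.
rewrite [RHS](reindex (fun u => enum_rank (t^-1 * u)%g)) /=; last first.
  exists (fun i => t * enum_val i)%g => [u _|i _]; first by rewrite enum_rankK mulKVg.
  by rewrite mulKg enum_valK.
apply: eq_bigr => u _; rewrite !mxE hornerM hornerXn !enum_rankK invgK mulKVg.
rewrite mulrCA; congr (_ * _); rewrite /wg_rat /wg_num invMg invgK.
by rewrite mulrC divfK // [in LHS]mxE.
Qed.

(** A solution [W] provides an inverse matrix. This both shows that the determinant does not vanish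
    at [x] and identifies [W] by Cramer's rule. *)
Lemma wg_rat_unique x (W : 'S_m -> R) :
  (forall t, \sum_u x ^+ #|porbits u| * W (u^-1 * t)%g = (t == 1%g)%:R) ->
  wg_den.[x] != 0 /\ forall s, W s = wg_rat x s.
Proof.
move=> GW; pose ev (A : 'M[{poly R}]_N) := map_mx (horner_eval x) A.
pose W' := \matrix_(i < N, j < N) W ((enum_val i)^-1 * enum_val j)%g.
have MW : ev gram_mx *m W' = 1%:M.
  apply/matrixP => i j; rewrite !mxE.
  rewrite (reindex (fun u => enum_rank (enum_val i * u)%g)) /=; last first.
    exists (fun l => (enum_val i)^-1 * enum_val l)%g => [u _|l _].
      by rewrite enum_rankK mulKg.
    by rewrite mulKVg enum_valK.
  rewrite -(inj_eq enum_val_inj) eq_sym -(inj_eq (mulgI (enum_val i)^-1%g)) mulVg -GW.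
  apply: eq_bigr => u _; rewrite !mxE /horner_eval hornerXn enum_rankK mulKg.
  by rewrite invMg mulgA.
have detE : \det (ev gram_mx) = wg_den.[x] by rewrite det_map_mx.
have den0 : wg_den.[x] != 0.
  by have [+ _] := mulmx1_unit MW; rewrite unitmxE detE unitfE.
split=> // s; apply: (mulIf den0); rewrite /wg_rat divfK //.
have : \adj (ev gram_mx) = wg_den.[x] *: W'.
  rewrite -[LHS]mul1mx -(mulmx1C MW) -mulmxA mul_mx_adj detE.
  by rewrite mul_mx_scalar.
move/matrixP/(_ (enum_rank s^-1%g) (enum_rank 1%g)).
rewrite -map_mx_adj !mxE !enum_rankK invgK mulg1 mulrC => <-.
by rewrite /wg_num [in RHS]mxE.
Qed.

End RationalWeingarten.

Section RationalAgreement.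
Variables (R : fieldType) (K : nat).
Implicit Types (f : nat -> R) (h : R -> R).

(* [f] on the integers [n >= K] and [h] on the field are values of one rational
   function, without poles at these integers. *)
Definition rational_agree f h : Prop :=
  exists num den : {poly R},
    (forall n, (K <= n)%N -> den.[n%:R] != 0 /\ f n = num.[n%:R] / den.[n%:R]) /\
    (forall x, den.[x] != 0 -> h x = num.[x] / den.[x]).

Lemma rational_agree_cst a : rational_agree (fun=> a) (fun=> a).
Proof.
by exists a%:P, 1; split=> [n _|x _]; rewrite !hornerE ?oner_eq0 ?divr1.
Qed.

Lemma rational_agreeD f1 h1 f2 h2 : rational_agree f1 h1 -> rational_agree f2 h2 ->
  rational_agree (fun n => f1 n + f2 n) (fun x => h1 x + h2 x).
Proof.
move=> [a1 [b1 [fE1 hE1]]] [a2 [b2 [fE2 hE2]]].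
exists (a1 * b2 + a2 * b1), (b1 * b2); split=> [n le_n|x]; rewrite !hornerE.
  have [b1n ->] := fE1 n le_n; have [b2n ->] := fE2 n le_n.
  by rewrite mulf_neq0 // addf_div.
by rewrite mulf_eq0 negb_or => /andP[b1x b2x]; rewrite hE1 // hE2 // addf_div.
Qed.

Lemma rational_agreeM f1 h1 f2 h2 : rational_agree f1 h1 -> rational_agree f2 h2 ->
  rational_agree (fun n => f1 n * f2 n) (fun x => h1 x * h2 x).
Proof.
move=> [a1 [b1 [fE1 hE1]]] [a2 [b2 [fE2 hE2]]].
exists (a1 * a2), (b1 * b2); split=> [n le_n|x]; rewrite !hornerE.
  have [b1n ->] := fE1 n le_n; have [b2n ->] := fE2 n le_n.
  by rewrite mulf_neq0 // mulf_div.
by rewrite mulf_eq0 negb_or => /andP[b1x b2x]; rewrite hE1 // hE2 // mulf_div.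
Qed.

Lemma eq_rational_agree f1 h1 f2 h2 : f1 =1 f2 -> h1 =1 h2 ->
  rational_agree f1 h1 -> rational_agree f2 h2.
Proof.
move=> ef eh [a [b [fE hE]]]; exists a, b.
by split=> [n /fE|x /hE]; rewrite ?ef ?eh.
Qed.

Lemma rational_agree_sum (J : Type) (r : seq J) (P : pred J) (f : J -> nat -> R) (h : J -> R -> R) :
  (forall j, P j -> rational_agree (f j) (h j)) ->
  rational_agree (fun n => \sum_(j <- r | P j) f j n) (fun x => \sum_(j <- r | P j) h j x).
Proof.
move=> fh; elim: r => [|j r IHr].
  by apply: eq_rational_agree (rational_agree_cst 0) => ?; rewrite big_nil.
have [Pj|NPj] := boolP (P j); last first.
  by apply: eq_rational_agree IHr => ?; rewrite big_cons (negPf NPj).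
by apply: eq_rational_agree (rational_agreeD (fh j Pj) IHr) => ?; rewrite big_cons Pj.
Qed.

Lemma rational_agree_prod (J : Type) (r : seq J) (P : pred J) (f : J -> nat -> R)
    (h : J -> R -> R) :
  (forall j, P j -> rational_agree (f j) (h j)) ->
  rational_agree (fun n => \prod_(j <- r | P j) f j n) (fun x => \prod_(j <- r | P j) h j x).
Proof.
move=> fh; elim: r => [|j r IHr].
  by apply: eq_rational_agree (rational_agree_cst 1) => ?; rewrite big_nil.
have [Pj|NPj] := boolP (P j); last first.
  by apply: eq_rational_agree IHr => ?; rewrite big_cons (negPf NPj).
by apply: eq_rational_agree (rational_agreeM (fh j Pj) IHr) => ?; rewrite big_cons Pj.
Qed.

End RationalAgreement.

(** * Pair partitions *)

Section PairPartitions.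
Variables (k : nat) (eps : {ffun 'I_k -> bool}).
Implicit Types (p q : {set {set 'I_k}}) (i j x : 'I_k) (b E : {set 'I_k}).
Local Notation D := (minus_set eps).

Lemma pair_partition_pair p c : p \in pair_partitions eps -> c \in p ->
  exists i i', [/\ ~~ eps i, eps i' & c = [set i; i']%SET].
Proof.
rewrite inE => /andP[_ /forall_inP pairs] /pairs /existsP[i /existsP[i' /and3P[? ? /eqP ?]]].
by exists i, i'.
Qed.

(** The pairs partition the indices, and each has one index of either sign, hence two distinct
    elements; so every index has exactly one companion. *)
Lemma partner_pair p i j : p \in pair_partitions eps ->
  ([set i; j]%SET \in p) = (j == partner p i).
Proof.
move=> pP; have [pp _] : finset.partition p [set: 'I_k]%SET /\ True.
  by move: pP; rewrite inE => /andP[].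
have [/eqP cov triv _] := and3P pp.
have uniq_pair i1 j1 j2 : [set i1; j1]%SET \in p -> [set i1; j2]%SET \in p -> j1 = j2.
  move=> p1 p2; have e : [set i1; j1]%SET = [set i1; j2]%SET.
    by transitivity (finset.pblock p i1); [apply/esym|];
      apply: (def_pblock triv) => //; rewrite !inE eqxx.
  have [a [a' [Na a'e ea]]] := pair_partition_pair pP p1.
  have neq j' : [set i1; j']%SET = [set a; a']%SET -> j' != i1.
    move=> e'; apply: contraNneq Na => ji; rewrite ji finset.setUid in e'.
    have := set11 i1; rewrite e' !inE.
    have : a \in [set i1]%SET by rewrite e' !inE eqxx.
    have : a' \in [set i1]%SET by rewrite e' !inE eqxx orbT.
    by rewrite !inE => /eqP <- /eqP ->.
  have n1 := neq _ ea; have n2 := neq j2; rewrite -e ea in n2.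
  have : j1 \in [set i1; j2]%SET by rewrite -e !inE eqxx orbT.
  by rewrite !inE (negPf n1) /= => /eqP.
have ex_pair : exists j0, [set i; j0]%SET \in p.
  have iP : finset.pblock p i \in p by rewrite pblock_mem // cov inE.
  have ib : i \in finset.pblock p i by rewrite mem_pblock cov inE.
  have [a [a' [_ _ e]]] := pair_partition_pair pP iP.
  move: ib; rewrite e !inE => /orP[]/eqP->; first by exists a'; rewrite -e.
  by exists a; rewrite finset.setUC -e.
rewrite /partner; case: pickP => [j0 j0P|none] /=.
  by apply/idP/eqP => [jP|->] //; apply: uniq_pair jP j0P.
by have [j0 j0P] := ex_pair; have := none j0; rewrite j0P.
Qed.

Lemma partnerK p : p \in pair_partitions eps -> involutive (partner p).
Proof.
move=> pP i; apply/esym/eqP; rewrite -partner_pair // finset.setUC.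
by rewrite partner_pair.
Qed.

Lemma eps_partner p i : p \in pair_partitions eps -> eps (partner p i) = ~~ eps i.
Proof.
move=> pP; have iP : [set i; partner p i]%SET \in p by rewrite partner_pair.
have [a [a' [Na a'e e]]] := pair_partition_pair pP iP.
have : partner p a = a' by apply/esym/eqP; rewrite -partner_pair // -e.
have : i \in [set a; a']%SET by rewrite -e !inE eqxx.
rewrite !inE => /orP[]/eqP-> pa; first by rewrite pa a'e Na.
by rewrite -pa partnerK // pa a'e (negPf Na).
Qed.

Lemma partner_neq p i : p \in pair_partitions eps -> i != partner p i.
Proof.
by move=> pP; apply/eqP => e; have := eps_partner i pP; rewrite -e; case: (eps i).
Qed.

Lemma pairs_invariantP p b : p \in pair_partitions eps ->
  reflect (forall i, (partner p i \in b) = (i \in b)) (pairs_invariant p b).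
Proof.
move=> pP; have cardI i : #|[set i; partner p i]%SET :&: b|%SET =
    ((i \in b) + (partner p i \in b))%N.
  rewrite (cardsD1 i) !inE eqxx /=; congr addn.
  rewrite (cardsD1 (partner p i)) !inE eqxx orbT eq_sym partner_neq //= -[RHS]addn0.
  congr addn; apply: eq_card0 => z; rewrite !inE.
  by case: (z == i); case: (z == partner p i); rewrite ?andbF.
apply: (iffP forall_inP) => [inv i|inv c cp].
  have : [set i; partner p i]%SET \in p by rewrite partner_pair.
  by move/inv; rewrite cardI; case: (i \in b); case: (_ \in b).
have [a [a' [_ _ e]]] := pair_partition_pair pP cp.
have a'E : a' = partner p a by apply/eqP; rewrite -partner_pair // -e.
by rewrite e a'E cardI inv; case: (a \in b).
Qed.

Lemma partner_restr p b i : p \in pair_partitions eps -> pairs_invariant p b ->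
  i \in b -> partner (p ::&: b)%SET i = partner p i.
Proof.
move=> pP /(pairs_invariantP _ pP) inv ib.
rewrite {1}/partner (@eq_pick _ _ (pred1 (partner p i))).
  by case: pickP => [j /eqP //|/(_ (partner p i))]; rewrite /= eqxx.
move=> j /=; rewrite inE partner_pair //; case: eqP => [->|//] /=.
by rewrite finset.subUset !finset.sub1set ib inv ib.
Qed.

Definition sub_perm E (u : {perm 'I_k}) : {perm {x | x \in E}} :=
  insubd (1%g : {perm {x | x \in E}}) [ffun x : {x | x \in E} => insubd x (u (val x))].

Lemma sub_permE E (u : {perm 'I_k}) (x : {x | x \in E}) :
  (forall z, z \in E -> u z \in E) -> val (sub_perm E u x) = u (val x).
Proof.
move=> uE; rewrite -pvalE (_ : pval _ = [ffun x : {x | x \in E} => insubd x (u (val x))]).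
  by rewrite ffunE insubdK //; apply: uE (valP x).
apply: (insubdK (1%g : {perm {x | x \in E}})); apply/injectiveP => x1 x2; rewrite !ffunE.
move/(congr1 val); rewrite !insubdK; try by apply: uE (valP _).
by move/perm_inj/val_inj.
Qed.

Section Quotient.
Variables p q : {set {set 'I_k}}.
Hypotheses (pP : p \in pair_partitions eps) (qP : q \in pair_partitions eps).

(** Extending $pq^{-1}$ by the identity on the [.] indices keeps all permutations on the one set
    ['I_k], whatever the block. *)
Definition quotient_fun x := if eps x then partner p (partner q x) else x.

Lemma eps_quotient_fun x : eps (quotient_fun x) = eps x.
Proof.
by rewrite /quotient_fun; case: ifP => ex //; rewrite !eps_partner // ex.
Qed.

Lemma quotient_fun_inj : injective quotient_fun.
Proof.
move=> x y e; have := eps_quotient_fun x; rewrite e eps_quotient_fun => exy.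
move: e; rewrite /quotient_fun exy; case: ifP => // _.
by move/(inv_inj (partnerK pP))/(inv_inj (partnerK qP)).
Qed.

Definition quotient_perm : {perm 'I_k} := perm quotient_fun_inj.

Lemma quot_perm_restr b : pairs_invariant p b -> pairs_invariant q b ->
  quot_perm (D :&: b) (p ::&: b) (q ::&: b) = sub_perm (D :&: b) quotient_perm.
Proof.
move=> pb qb; rewrite /quot_perm /sub_perm; congr insubd; apply/ffunP => x.
have := valP x; rewrite !inE => /andP[ex xb].
rewrite !ffunE permE /quotient_fun ex (partner_restr qP qb xb).
by rewrite (partner_restr pP pb) // (pairs_invariantP _ qP qb).
Qed.

Lemma quot_perm_sub : quot_perm D p q = sub_perm D quotient_perm.
Proof.
rewrite /quot_perm /sub_perm; congr insubd; apply/ffunP => x.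
have := valP x; rewrite !inE => ex.
by rewrite !ffunE permE /quotient_fun ex.
Qed.

Lemma quotient_perm_out x : ~~ eps x -> quotient_perm x = x.
Proof. by rewrite permE /quotient_fun => /negPf ->. Qed.

Lemma perm_len_quotient : quot_len eps p q = perm_len quotient_perm.
Proof.
rewrite /quot_len quot_perm_sub; apply/esym/(perm_len_transfer val_inj) => [x|z zD].
  by rewrite sub_permE // => z; rewrite !inE permE eps_quotient_fun.
apply: quotient_perm_out; apply: contra zD => ez.
have zD : z \in D by rewrite inE.
by apply/codomP; exists (exist _ z zD).
Qed.

End Quotient.

End PairPartitions.

Section SubsetEmbedding.
Variables (k : nat) (E : {set 'I_k}).
Implicit Types u t : {perm 'I_k}.

Definition embed (i : 'I_#|{: {x | x \in E}}|) : 'I_k := val (enum_val i).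

Definition pull (u : {perm 'I_k}) : 'S_#|{: {x | x \in E}}| := ord_conj (sub_perm E u).

Lemma embed_inj : injective embed.
Proof. by move=> i j /val_inj/enum_val_inj. Qed.

Lemma embed_codom z : (z \in codom embed) = (z \in E).
Proof.
apply/codomP/idP => [[i ->]|zE]; first exact: valP.
by exists (enum_rank (exist _ z zE)); rewrite /embed enum_rankK.
Qed.

Lemma pullE u i : (forall z, z \in E -> u z \in E) -> u (embed i) = embed (pull u i).
Proof. by move=> uE; rewrite /embed /pull permE /ord_conj_fun enum_rankK sub_permE. Qed.

Lemma eq_pull u t : {in E, u =1 t} -> pull u = pull t.
Proof.
move=> ut; rewrite /pull; congr ord_conj; rewrite /sub_perm; congr insubd.
by apply/ffunP => x; rewrite !ffunE ut // (valP x).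
Qed.

End SubsetEmbedding.

(** * Merged blocks *)

Section ColourExpansion.
Variables (R : realType) (x : R).
Hypothesis x0 : x != 0.

(** With $y=1/x$, the number of cycles enters as $x^{m-|u|}=x^my^{|u|}$; the factor $x^m$ moves to
    the Weingarten function. *)
Lemma normalized_inverse m (t : 'S_m) : (wg_den R m).[x] != 0 ->
  \sum_u x^-1 ^+ perm_len u * (x ^+ m * wg_rat x (u^-1 * t)%g) = (t == 1%g)%:R.
Proof.
move=> den0; rewrite -(wg_rat_inverse t den0); apply: eq_bigr => u _; rewrite mulrA; congr (_ * _).
have le_m : (#|porbits u| <= m)%N by have := card_porbits_le u; rewrite card_ord.
have -> : x ^+ m = x ^+ (m - #|porbits u|) * x ^+ #|porbits u| by rewrite -exprD subnK.
by rewrite /perm_len card_ord mulrA -exprMn mulVf // expr1n mul1r.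
Qed.

Variables (k : nat) (I : finType) (c : 'I_k -> I).
Hypothesis den0 : forall m, (m <= k)%N -> (wg_den R m).[x] != 0.

Let den0_sub (E : {set 'I_k}) : (wg_den R #|{: {z | z \in E}}|).[x] != 0.
Proof. by apply: den0; rewrite card_sig -[X in (_ <= X)%N]card_ord max_card. Qed.

Definition normalized_wg (E : {set 'I_k}) (s : {perm 'I_k}) : R :=
  x ^+ #|E| * wg_rat x (pull E s).

(** The symmetric group is trivial here, and the inverse relation at the identity has a single
    term. *)
Lemma normalized_wg_small (E : {set 'I_k}) s : (#|E| <= 1)%N -> normalized_wg E s = 1.
Proof.
rewrite /normalized_wg => E1; have S1 (u : 'S_#|{: {z | z \in E}}|) : u = 1%g.
  apply/permP => i; rewrite perm1; apply: val_inj.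
  have cardE : #|{: {z | z \in E}}| = #|E| by rewrite card_sig.
  have small (v : 'I_#|{: {z | z \in E}}|) : val v = 0%N.
    by apply/eqP; rewrite -leqn0 -ltnS (leq_trans (ltn_ord v)) // cardE.
  by rewrite !small.
have := normalized_inverse 1%g (den0_sub E).
rewrite eqxx (bigD1 1%g) //= big1 => [|u]; last by rewrite [u]S1 eqxx.
rewrite perm_len1 expr0 mul1r addr0 invg1 mulg1 => h.
transitivity (true%:R : R) => //; rewrite -h [pull E s]S1.
by congr (_ ^+ _ * _); rewrite card_sig.
Qed.

(** The inverse relations of the separate classes, transported to ['I_k] and multiplied, say that
    the product inverts the coloured Gram function; the monotone series does too. *)
Lemma colour_expansion s : `|x^-1| * (k * k)%:R < 1 -> preserves c s ->
  \prod_i normalized_wg (colour_class c i) s = monotone_series c x^-1 0 s.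
Proof.
move=> small_x cs.
pose W u := if preserves c u
  then \prod_i normalized_wg (colour_class c i) (restr c i u) else 0.
have restr_pull i u : preserves c u ->
    normalized_wg (colour_class c i) (restr c i u) = normalized_wg (colour_class c i) u.
  move=> cu; rewrite /normalized_wg; congr (_ * wg_rat _ _); apply: eq_pull => z.
  by rewrite inE restrE // => ->.
rewrite -(gram_inverse_expansion small_x (W := W)).
  by rewrite /W cs; apply: eq_bigr => i _; rewrite restr_pull.
apply: (@gram_inverse_product _ x^-1 _ _ c (fun i => normalized_wg (colour_class c i))).
move=> i t tE.
pose V (w : 'S_#|{: {z | z \in colour_class c i}}|) : R :=
  x ^+ #|colour_class c i| * wg_rat x w.
have pullP u : perm_on (colour_class c i) u ->
    forall j, u (embed (E := colour_class c i) j) = embed (pull (colour_class c i) u j).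
  by move=> uE j; apply: pullE => z zE; rewrite perm_closed.
have VP w : \sum_u x^-1 ^+ perm_len u * V (u^-1 * w)%g = (w == 1%g)%:R.
  rewrite -(normalized_inverse w (den0_sub _)); apply: eq_bigr => u _.
  by congr (_ * (x ^+ _ * _)); rewrite card_sig.
by rewrite -(gram_inverse_pull (@embed_inj k _) (@embed_codom k _) pullP VP tE).
Qed.

End ColourExpansion.

Section MergedBlocks.
Variables (k T : nat) (eps : {ffun 'I_k -> bool}) (pi : 'I_T -> {set 'I_k}).
Hypothesis pi_part : labelled_partition pi.
Implicit Types (A : {set 'I_T}) (i j : 'I_k) (b : {set 'I_k}) (t : 'I_T).
Local Notation D := (minus_set eps).

Lemma block_ex i : exists t, i \in pi t.
Proof.
have [_ /and3P[/eqP cov _ _]] := pi_part.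
have : i \in finset.cover [set pi t | t : 'I_T]%SET by rewrite cov inE.
by case/finset.bigcupP => _ /imsetP[t _ ->] it; exists t.
Qed.

Lemma block_neq0 t : pi t != finset.set0%SET.
Proof.
have [_ /and3P[_ _ N0]] := pi_part; apply: contraNneq N0 => <-.
exact: imset_f.
Qed.

Lemma block_uniq i t t' : i \in pi t -> i \in pi t' -> t = t'.
Proof.
have [pi_inj /and3P[_ triv _]] := pi_part => it it'; apply: pi_inj.
transitivity (finset.pblock [set pi t | t : 'I_T]%SET i); [apply/esym|];
  by apply: (finset.def_pblock triv) => //; apply: imset_f.
Qed.

Definition merged A : {set 'I_k} := (\bigcup_(t in A) pi t)%SET.

Lemma in_merged A i : (i \in merged A) = [forall t, (t \notin A) ==> (i \notin pi t)].
Proof.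
apply/finset.bigcupP/fintype.forallP => [[t tA it] t'|h].
  by apply/implyP; apply: contra => it'; rewrite -(block_uniq it it').
have [t it] := block_ex i; exists t => //.
by apply: contraTT it => tA; have /implyP := h t; apply.
Qed.

Lemma merge_blocksP A b : b \in merge_blocks pi A ->
  b = merged A \/ exists2 t, t \notin A & b = pi t.
Proof.
rewrite !inE => /andP[_ /orP[/eqP ->|/imsetP[t tA ->]]]; first by left.
by right; exists t => //; move: tA; rewrite inE.
Qed.

Lemma unmerged_block A t : t \notin A -> pi t \in merge_blocks pi A.
Proof.
move=> tA; rewrite !inE block_neq0 /=; apply/orP; right.
by apply: imset_f; rewrite inE.
Qed.

Lemma merge_blocks_uniq A b b' i : b \in merge_blocks pi A -> b' \in merge_blocks pi A ->
  i \in b -> i \in b' -> b = b'.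
Proof.
move=> /merge_blocksP[->|[t tA ->]] /merge_blocksP[->|[t' tA' ->]] //.
- by rewrite in_merged => /fintype.forallP/(_ t'); rewrite tA' /= => /negPf ->.
- by move=> it; rewrite in_merged => /fintype.forallP/(_ t); rewrite tA it.
- by move=> it it'; rewrite (block_uniq it it').
Qed.

Lemma merge_blocks_ex A i : exists2 b, b \in merge_blocks pi A & i \in b.
Proof.
have [t it] := block_ex i; have [tA|tA] := boolP (t \in A); last first.
  by exists (pi t); first exact: unmerged_block.
have iM : i \in merged A by apply/finset.bigcupP; exists t.
exists (merged A) => //; rewrite !inE eqxx /= andbT.
by apply/finset.set0Pn; exists i.
Qed.

Lemma merge_blocks_partition A : finset.partition (merge_blocks pi A) [set: 'I_k]%SET.
Proof.
apply/and3P; split; last by rewrite !inE eqxx.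
  apply/eqP/finset.setP => i; rewrite inE; have [b bA ib] := merge_blocks_ex A i.
  by apply/finset.bigcupP; exists b.
apply/finset.trivIsetP => b b' bA b'A; apply: contraNT => /pred0Pn[i /andP[ib ib']].
by apply/eqP/(merge_blocks_uniq bA b'A ib ib').
Qed.

Definition block_of A i : {set 'I_k} := finset.pblock (merge_blocks pi A) i.

Lemma block_of_mem A i : (block_of A i \in merge_blocks pi A) && (i \in block_of A i).
Proof.
have /and3P[/eqP cov _ _] := merge_blocks_partition A.
by rewrite /block_of finset.pblock_mem ?finset.mem_pblock cov inE.
Qed.

Lemma block_ofE A i b : b \in merge_blocks pi A -> (block_of A i == b) = (i \in b).
Proof.
move=> bA; have /andP[iA ib] := block_of_mem A i.
by apply/eqP/idP => [<- //|ib']; apply: merge_blocks_uniq iA bA ib ib'.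
Qed.

(** The merged block is the complement of the unmerged ones, so two indices share a block unless an
    unmerged block separates them. *)
Lemma eq_block_of A i j : (block_of A i == block_of A j) =
  [forall t, (t \notin A) ==> transp_invariant (i, j) (pi t)].
Proof.
have /andP[jA jb] := block_of_mem A j; rewrite block_ofE //.
apply/idP/fintype.forallP => [ij t|h].
  apply/implyP => tA; have ptA := unmerged_block tA.
  rewrite /transp_invariant /= -!(block_ofE _ ptA); apply/eqP; congr (_ == _).
  by apply/eqP; rewrite block_ofE.
have [eM|[t tA e]] := merge_blocksP jA.
  rewrite eM in_merged; apply/fintype.forallP => t; apply/implyP => tA.
  have := h t; rewrite tA /= => /eqP /= ->.
  by move: jb; rewrite eM in_merged => /fintype.forallP/(_ t); rewrite tA.
by have := h t; rewrite tA /= /transp_invariant /= e => /eqP ->; rewrite -e.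
Qed.

(** Each [.] index gets a colour of its own, so that colour preserving permutations move [-] indices
    only, inside the blocks of $\pi_A$. *)
Definition block_colour A i : 'I_k + {set 'I_k} :=
  if eps i then inr (block_of A i) else inl i.

(** Colours other than the blocks of $\pi_A$ have at most one element and contribute 1; the sets
    [D :&: b] partition [D], which collects the powers of [x]. *)
Lemma prod_block_colour (R : realType) (x : R) A (s : {perm 'I_k}) :
  x != 0 -> (forall m, (m <= k)%N -> (wg_den R m).[x] != 0) ->
  \prod_i normalized_wg x (colour_class (block_colour A) i) s =
  x ^+ #|D| * \prod_(b in merge_blocks pi A) wg_rat x (pull (D :&: b)%SET s).
Proof.
move=> x0 den0; rewrite big_sumType /= big1 ?mul1r => [|i _]; last first.
  apply: normalized_wg_small => //; rewrite -(cards1 i); apply: subset_leq_card.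
  apply/fintype.subsetP => j; rewrite !inE /block_colour.
  by case: ifP => // _ /eqP[->].
rewrite (bigID (fun b => b \in merge_blocks pi A)) /= [X in _ * X]big1 ?mulr1 => [|b bA].
  have classE b : b \in merge_blocks pi A ->
      colour_class (block_colour A) (inr b) = (D :&: b)%SET.
    move=> bA; apply/finset.setP => j; rewrite !inE /block_colour.
    case: (eps j) => //=; rewrite -(block_ofE j bA).
    by apply/eqP/eqP => [[]|->].
  rewrite (eq_bigr (fun b => x ^+ #|D :&: b|%SET * wg_rat x (pull (D :&: b)%SET s))).
    rewrite big_split /= -expr_sum; congr (_ ^+ _ * _).
    rewrite -[RHS]sum1_card (eq_bigl (fun i => (i \in [set: 'I_k]%SET) && (i \in D))).
      rewrite (set_partition_big_cond _ (merge_blocks_partition A)) /=.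
      by apply: eq_bigr => b _; rewrite -sum1_card; apply: eq_bigl => i; rewrite !inE andbC.
    by move=> i; rewrite !inE.
  by move=> b /classE; rewrite /normalized_wg => ->.
apply: normalized_wg_small => //; rewrite (_ : colour_class _ _ = finset.set0%SET) ?cards0 //.
apply/finset.setP => j; rewrite !inE /block_colour; case: (eps j) => //.
apply/negP => /eqP[e]; case/negP: bA; rewrite -e.
by have /andP[] := block_of_mem A j.
Qed.

Lemma preserves_block_colour A p q (pP : p \in pair_partitions eps)
    (qP : q \in pair_partitions eps) :
  (forall t, t \notin A -> pairs_invariant p (pi t) && pairs_invariant q (pi t)) ->
  preserves (block_colour A) (quotient_perm pP qP).
Proof.
move=> inv; apply/preservesP => i; rewrite /block_colour permE eps_quotient_fun //.
case ei: (eps i); rewrite /quotient_fun ei //; congr (inr _); apply/eqP; rewrite eq_block_of.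
apply/fintype.forallP => t; apply/implyP => /inv/andP[pt qt].
by rewrite /transp_invariant /= (pairs_invariantP _ pP pt) (pairs_invariantP _ qP qt).
Qed.

Lemma merge_blocks_invariant A p q (pP : p \in pair_partitions eps)
    (qP : q \in pair_partitions eps) :
  [forall b in merge_blocks pi A, pairs_invariant p b && pairs_invariant q b] =
  [forall t, (t \notin A) ==> pairs_invariant p (pi t) && pairs_invariant q (pi t)].
Proof.
apply/forall_inP/fintype.forallP => [inv t|inv b /merge_blocksP[->|[t tA ->]]].
- by apply/implyP => tA; apply: inv; apply: unmerged_block.
- apply/andP; split.
    apply/(pairs_invariantP _ pP) => i; rewrite !in_merged; apply: eq_forallb => t.
    have := inv t; case: (t \in A) => //= /andP[pt _].
    by rewrite (pairs_invariantP _ pP pt).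
  apply/(pairs_invariantP _ qP) => i; rewrite !in_merged; apply: eq_forallb => t.
  have := inv t; case: (t \in A) => //= /andP[_ qt].
  by rewrite (pairs_invariantP _ qP qt).
- by have := inv t; rewrite tA.
Qed.

End MergedBlocks.

(** * Inclusion-exclusion *)

(** Passing to complements, this is the expansion of a product whose factors are $1-1$ for the
    elements of [S] and $0+1$ for the others. *)
Lemma alternating_subsets (R : comPzRingType) (I : finType) (S : {set I}) :
  \sum_(A : {set I}) (-1) ^+ (#|I| - #|A|) * (~: A \subset S)%SET%:R =
  (S == finset.set0)%:R :> R.
Proof.
rewrite (reindex_inj (can_inj (@finset.setCK I))) /=.
pose F i : R := if i \in S then -1 else 0.
transitivity (\prod_i (F i + 1)).
  rewrite bigA_distr; apply: eq_bigr => B _; rewrite finset.setCK.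
  rewrite -[#|I|]cardsT -cardsDS ?finset.subsetT // finset.setTD finset.setCK.
  rewrite -prodr_const -big_mkcond.
  have [/fintype.subsetP BS|/fintype.subsetPn[i iB iS]] := boolP (B \subset S).
    by rewrite mulr1; apply: eq_bigr => i /BS iS; rewrite /F iS.
  by rewrite mulr0 (bigD1 i) //= /F (negPf iS) mul0r.
have [S0|[i iS]] := set_0Vmem S.
  by rewrite S0 eqxx big1 // => i _; rewrite /F S0 inE add0r.
rewrite (bigD1 i) //= /F iS addNr mul0r; case: eqP => // e.
by rewrite e inE in iS.
Qed.

Lemma word_perm_foldr k (w : seq ('I_k * 'I_k)) x :
  word_perm w x = foldr (fun ij : 'I_k * 'I_k => tperm ij.1 ij.2) x w.
Proof. by elim: w => [|ij w IHw] /=; rewrite ?perm1 // permM IHw. Qed.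

Lemma perm_len_word k (w : seq ('I_k * 'I_k)) :
  (perm_len (word_perm w) <= size w)%N.
Proof.
elim: w => [|ij w IHw] /=; first by rewrite perm_len1.
rewrite -perm_lenV invMg tpermV; apply: leq_trans (perm_len_mul_tperm_le _ _ _) _.
by rewrite perm_lenV.
Qed.

Lemma odd_word_perm k (w : seq ('I_k * 'I_k)) :
  all (fun ij : 'I_k * 'I_k => ij.1 != ij.2) w -> word_perm w = odd (size w) :> bool.
Proof.
elim: w => [|ij w IHw] /=; first by rewrite odd_perm1.
by move=> /andP[neq /IHw IH]; rewrite odd_permM odd_tperm IH neq addbT.
Qed.

Section PathCounts.
Variables (k T : nat) (eps : {ffun 'I_k -> bool}) (pi : 'I_T -> {set 'I_k}).
Variables p q : {set {set 'I_k}}.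
Hypotheses (pi_part : labelled_partition pi).
Hypotheses (pP : p \in pair_partitions eps) (qP : q \in pair_partitions eps).
Local Notation D := (minus_set eps).
Local Notation sigma := (quotient_perm pP qP).
Implicit Types (w : seq ('I_k * 'I_k)) (A : {set 'I_T}) (t : 'I_T).

Definition sorted_word w : bool :=
  all (fun ij : 'I_k * 'I_k => [&& ij.1 \in D, ij.2 \in D & (ij.1 < ij.2)%N]) w
  && sorted (fun ij ij' : 'I_k * 'I_k => (ij.2 <= ij'.2)%N) w.

Definition invariant_blocks w : {set 'I_T} :=
  [set t | [&& pairs_invariant p (pi t), pairs_invariant q (pi t)
    & all (fun ij : 'I_k * 'I_k => transp_invariant ij (pi t)) w]]%SET.

(** The length [L] is free here, which makes the counts the coefficients of one power series;
    [wg_paths] starts at the length of [sigma]. *)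
Definition path_count L : nat :=
  (\sum_(w : L.-tuple ('I_k * 'I_k) | sorted_word w && (word_perm w == sigma))
     (invariant_blocks w == finset.set0))%N.

Definition compatible A : bool := [forall b in merge_blocks pi A,
  pairs_invariant p b && pairs_invariant q b].

Lemma monotone_block_colour A w : monotone (block_colour eps pi A) 0 w =
  sorted_word w &&
  [forall t, (t \notin A) ==> all (fun ij : 'I_k * 'I_k => transp_invariant ij (pi t)) w].
Proof.
rewrite /monotone /sorted_word [RHS]andbAC; congr (_ && _).
have -> : [forall t, (t \notin A) ==> all (fun ij : 'I_k * 'I_k => transp_invariant ij (pi t)) w] =
    all (fun ij : 'I_k * 'I_k => [forall t, (t \notin A) ==> transp_invariant ij (pi t)]) w.
  apply/fintype.forallP/allP => [h ij ijw|h t].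
    by apply/fintype.forallP => t; apply/implyP => tA; have /implyP/(_ tA)/allP := h t; apply.
  apply/implyP => tA; apply/allP => ij /h /fintype.forallP/(_ t); by rewrite tA.
rewrite -all_predI; apply: eq_all => -[i j] /=; rewrite andbT.
rewrite -(eq_block_of pi_part) /block_colour !inE.
case: (eps i); case: (eps j) => //=; case: ltnP => //= lt_ij.
by apply/eqP => -[ij]; rewrite ij ltnn in lt_ij.
Qed.

(** Both conditions on [A] concern its unmerged blocks only, and together they ask that these be
    invariant under [p], [q] and all letters: the form needed for [alternating_subsets]. *)
Lemma compatible_monotone A w :
  compatible A && monotone (block_colour eps pi A) 0 w =
  sorted_word w && (~: A \subset invariant_blocks w)%SET.
Proof.
rewrite /compatible (merge_blocks_invariant pi_part A pP qP) monotone_block_colour.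
rewrite andbCA; congr (_ && _).
apply/andP/fintype.subsetP => [[/fintype.forallP inv /fintype.forallP tr] t|h].
  rewrite /invariant_blocks !inE => tA; have /implyP/(_ tA)/andP[pt qt] := inv t.
  by have /implyP/(_ tA) trt := tr t; apply/and3P.
split; apply/fintype.forallP => t; apply/implyP => tA;
  by have := h t; rewrite /invariant_blocks !inE => /(_ tA)/and3P[pt qt trt]; rewrite ?pt ?qt ?trt.
Qed.

Lemma path_count_alternating (R : comPzRingType) L :
  \sum_(A : {set 'I_T}) (-1) ^+ (T - #|A|) *
     (if compatible A then (monotone_count (block_colour eps pi A) 0 L sigma)%:R else 0)
  = (path_count L)%:R :> R.
Proof.
transitivity (\sum_(A : {set 'I_T}) \sum_(w : L.-tuple ('I_k * 'I_k)
    | sorted_word w && (word_perm w == sigma))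
      (-1) ^+ (#|'I_T| - #|A|) * (~: A \subset invariant_blocks w)%SET%:R : R).
  apply: eq_bigr => A _; rewrite -mulr_sumr card_ord; congr (_ * _).
  transitivity (\sum_(w : L.-tuple ('I_k * 'I_k))
      ((compatible A && monotone (block_colour eps pi A) 0 w) && (word_perm w == sigma))%:R : R).
    case: ifP => _ /=; last by rewrite big1.
    rewrite /monotone_count natr_sum big_mkcond /=; apply: eq_bigr => w _.
    by case: (monotone _ _ _).
  rewrite [RHS]big_mkcond; apply: eq_bigr => w _; rewrite compatible_monotone.
  by case: (sorted_word w); case: (_ == _); case: (_ \subset _).
rewrite exchange_big natr_sum /=; apply: eq_bigr => w _.
exact: alternating_subsets.
Qed.

(** Each letter changes the length by at most one and flips the sign. *)
Lemma path_count_eq0 L :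
  ~~ ((perm_len sigma <= L)%N && (odd L == odd (perm_len sigma))) -> path_count L = 0%N.
Proof.
move=> NL; rewrite /path_count big_pred0 // => w; apply: contraNF NL => /andP[/andP[sw _] /eqP ws].
have le_w := perm_len_word w; rewrite size_tuple in le_w.
rewrite -ws le_w odd_perm_len odd_word_perm ?size_tuple ?eqxx //.
apply/allP => ij /(allP sw) /and3P[_ _ lt]; apply: contraTneq lt => ->.
by rewrite ltnn.
Qed.

Lemma card_wg_paths l :
  #|wg_paths eps pi p q l| = path_count (quot_len eps p q + l).
Proof.
rewrite /path_count -sum1_card big_mkcond [RHS]big_mkcond; apply: eq_bigr => w _.
have -> : (w \in wg_paths eps pi p q l) =
  (sorted_word w && (word_perm w == sigma)) && (invariant_blocks w == finset.set0).
  rewrite inE /sorted_word -!andbA; case: allP => //= wD; congr (_ && _); congr (_ && _).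
    apply/fintype.forallP/eqP => [h|ws i].
      apply/permP => x; have [ex|Nex] := boolP (eps x).
        have := h (partner q x); rewrite (eps_partner x qP) ex /= (partnerK qP) => /eqP e.
        by rewrite word_perm_foldr -e permE /quotient_fun ex.
      (* On the [.] indices both permutations are the identity, because all letters transpose [-]
         indices. *)
      rewrite quotient_perm_out // word_perm_foldr.
      elim: (val w) wD => //= ij v IHv vD; rewrite IHv; last first.
        by move=> z zv; apply: vD; rewrite inE zv orbT.
      have /and3P[] := vD ij (mem_head _ _); rewrite !inE => e1 e2 _.
      by rewrite tpermD //; apply: contraNneq Nex => <-.
    apply/implyP => Nei; apply/eqP; rewrite -word_perm_foldr ws permE /quotient_fun.
    by rewrite (eps_partner i qP) Nei (partnerK qP).
  apply/negP/eqP => [h|h /existsP[t ht]].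
    apply/finset.setP => t; rewrite /invariant_blocks !inE; apply/negP => ht; apply: h.
    by apply/existsP; exists t.
  by have : t \in invariant_blocks w; [rewrite /invariant_blocks inE|rewrite h inE].
by case: (sorted_word w && _); case: (_ == finset.set0).
Qed.

End PathCounts.

(** * Expansion of the centered Weingarten function *)

Section WeingartenRational.
Variables (R : realType) (mu : forall n : nat, probability (unitary_borel R n) R).
Variable Wg : forall m : nat, nat -> 'S_m -> R.
Hypothesis WgP : weingarten_family mu Wg.

Lemma wg_rational m n : (m <= n)%N ->
  (wg_den R m).[n%:R] != 0 /\ forall s : 'S_m, @Wg m n s = wg_rat n%:R s.
Proof.
have [Wg0 Wg1] := WgP; move=> le_mn; apply: wg_rat_unique => t.
(* For [m = 0] there is no integration formula, only the convention that the value is 1; the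
   relation then has the single term $n^0\cdot1$. *)
have [m0|m_gt0] := posnP m.
  move: t; rewrite m0 => t; have S1 (u : 'S_0) : u = 1%g by apply/permP => -[].
  rewrite [t]S1 (bigD1 1%g) //= big1 => [|u]; last by rewrite [u]S1 eqxx.
  rewrite Wg0 eqxx addr0 mulr1 (_ : porbits _ = finset.set0) ?cards0 //.
  by apply/finset.setP => B; rewrite inE; apply/imsetP => -[[]].
have Wmn : is_weingarten (mu n) (@Wg m n) by apply: Wg1; rewrite m_gt0.
exact: (weingarten_relation Wmn le_mn t).
Qed.

Lemma wg_den_neq0 m : wg_den R m != 0.
Proof.
by have [+ _] := wg_rational (leqnn m); apply: contraNneq => ->; rewrite horner0.
Qed.

Lemma wg_rational_agree K m (s : 'S_m) : (m <= K)%N ->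
  rational_agree K (fun n => @Wg m n s) (fun x => wg_rat x s).
Proof.
move=> le_mK; exists (wg_num R s), (wg_den R m); split=> // n le_Kn.
by have [? ->] := wg_rational (leq_trans le_mK le_Kn).
Qed.

End WeingartenRational.

Section CenteredExpansion.
Variables (R : realType) (k T : nat) (eps : {ffun 'I_k -> bool}) (pi : 'I_T -> {set 'I_k}).
Variables p q : {set {set 'I_k}}.
Hypotheses (pi_part : labelled_partition pi).
Hypotheses (pP : p \in pair_partitions eps) (qP : q \in pair_partitions eps).
Local Notation D := (minus_set eps).
Local Notation sigma := (quotient_perm pP qP).

Lemma card_minus_set : balanced eps -> #|D| = k./2.
Proof.
move=> /eqP bal; have : (#|D| + #|D| = k)%N.
  transitivity #|'I_k|; last exact: card_ord.
  rewrite -(cardsC D); congr addn; rewrite /minus_set -bal.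
  by apply: eq_card => i; rewrite !inE.
by rewrite addnn => /(congr1 half); rewrite doubleK.
Qed.

(** The centered Weingarten function with each factor replaced by its rational extension, so that it
    makes sense at non-integer [x]. *)
Definition centered_rat (x : R) : R :=
  \sum_(A : {set 'I_T}) (-1) ^+ (T - #|A|) * (if compatible pi p q A
     then \prod_(b in merge_blocks pi A) wg_rat x (pull (D :&: b)%SET sigma) else 0).

Lemma centered_rational_agree (mu : forall n : nat, probability (unitary_borel R n) R)
    (Wg : forall m : nat, nat -> 'S_m -> R) : weingarten_family mu Wg -> balanced eps ->
  rational_agree k./2 (centered_wg Wg eps pi p q) centered_rat.
Proof.
move=> WgP bal; apply: rational_agree_sum => A _.
apply: rational_agreeM; first exact: rational_agree_cst.
rewrite /wg_merged -/(compatible pi p q A).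
case compA: (compatible pi p q A); last exact: rational_agree_cst.
apply: rational_agree_prod => b bA.
have /andP[pb qb] : pairs_invariant p b && pairs_invariant q b.
  by move: compA; rewrite /compatible => /forall_inP; apply.
rewrite /wg_perm (quot_perm_restr pP qP pb qb).
(* Every factor lives on at most $k/2$ points, so none has a pole at an integer $n\ge k/2$. *)
have le_m : (#|{: {x | x \in (D :&: b)%SET}}| <= k./2)%N.
  rewrite card_sig -(card_minus_set bal); apply: subset_leq_card.
  exact: finset.subsetIl.
exact: (wg_rational_agree WgP (pull (D :&: b)%SET sigma) le_m).
Qed.

Variable x : R.
Hypotheses (x0 : x != 0) (den0 : forall m, (m <= k)%N -> (wg_den R m).[x] != 0).
Hypothesis small_x : `|x^-1| * (k * k)%:R < 1.

(** For each [A] the product over blocks, scaled by $x^{|D|}$, is a monotone series; the alternating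
    sum is taken on partial sums and passes to the limit. *)
Lemma cvg_path_series :
  (series (fun L => (- x^-1) ^+ L * (path_count pi pP qP L)%:R : R) @ \oo -->
   x ^+ #|D| * centered_rat x)%classic.
Proof.
rewrite /centered_rat mulr_sumr.
rewrite (_ : series _ = fun N => \sum_(A : {set 'I_T}) (-1) ^+ (T - #|A|) *
  (if compatible pi p q A then
     series (monotone_coef (block_colour eps pi A) x^-1 0 sigma) N else 0)); last first.
  apply/funext => N; rewrite /series /=.
  under eq_bigr do rewrite -(path_count_alternating pi_part) mulr_sumr.
  rewrite exchange_big /=; apply: eq_bigr => A _.
  under eq_bigr do rewrite mulrCA.
  rewrite -mulr_sumr; congr (_ * _); case: ifP => _ //.
  by rewrite big1 // => L _; rewrite mulr0.
apply: cvg_big => [|A _]; first exact: add_continuous.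
rewrite mulrCA; apply: cvgMl_tmp; case: ifP => compA; last by rewrite mulr0; apply: cvg_cst.
rewrite -(prod_block_colour _ pi_part) // colour_expansion //; first exact: cvg_monotone_series.
apply: (preserves_block_colour pi_part) => t tA.
move: compA; rewrite /compatible (merge_blocks_invariant pi_part A pP qP).
by move=> /fintype.forallP/(_ t); rewrite tA.
Qed.

Lemma centered_rat_expansion :
  let c := fun g : nat => #|wg_paths eps pi p q (2 * g)|%:R * x ^- (2 * g) in
  cvgn (series c) /\
  centered_rat x = (-1) ^+ quot_len eps p q * x ^- (#|D| + quot_len eps p q) * limn (series c).
Proof.
move=> c; set l := quot_len eps p q.
pose u L := (- x^-1) ^+ L * (path_count pi pP qP L)%:R : R.
pose kappa : R := (- x^-1) ^+ l.
have kappa0 : kappa != 0 by rewrite expf_neq0 // oppr_eq0 invr_eq0.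
have lE : l = perm_len sigma by rewrite /l perm_len_quotient.
have u0 L : ~~ ((l <= L)%N && (odd L == odd l)) -> u L = 0.
  by rewrite lE => NL; rewrite /u path_count_eq0 ?mulr0.
have cu g : kappa * c g = u (l + 2 * g)%N.
  rewrite /c card_wg_paths /u exprD -mulrA; congr (_ * _); rewrite mulrC; congr (_ * _).
  by rewrite [RHS]exprM sqrrN -exprM exprVn.
(* The first [l] terms of [u] vanish, and so does every other one after them by parity; thus one
   term of [c] stands for two of [u]. *)
have sE n : series c n = kappa^-1 * series u (l + 2 * n)%N.
  apply: (mulfI kappa0); rewrite mulVKf //; elim: n => [|n IHn].
    rewrite muln0 addn0 /series /= big_nil mulr0 big_nat big1 // => L /= lt_L.
    by rewrite u0 // leqNgt lt_L.
  rewrite seriesSr mulrDr IHn cu mulnSr addnA addn2 !seriesSr -addrA; congr (_ + _).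
  by rewrite [X in _ + X]u0 ?addr0 // oddS oddD mul2n odd_double addbF; case: odd; rewrite andbF.
have lim_c : (series c @ \oo --> kappa^-1 * (x ^+ #|D| * centered_rat x))%classic.
  rewrite (funext sE); apply: cvgMl_tmp.
  apply: (cvg_comp (fun n => l + 2 * n)%N (series u)); last exact: cvg_path_series.
  apply/cvgnyPge => N; near=> n; apply: leq_trans (leq_addl _ _).
  rewrite (leq_trans _ (leq_pmull _ _)) //; near: n; exact: nbhs_infty_ge.
split; first by apply/cvg_ex; exists (kappa^-1 * (x ^+ #|D| * centered_rat x)).
rewrite (cvg_lim _ lim_c) // /kappa -[- x^-1]mulN1r exprMn exprVn exprD.
have cancel (a b s h : R) : a != 0 -> b != 0 -> s != 0 ->
    h = s * (a * b)^-1 * ((s * b^-1)^-1 * (a * h)).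
  by move=> a0 b0 s0; field; rewrite a0 b0 s0.
by apply: cancel; rewrite expf_neq0 // oppr_eq0 oner_eq0.
Unshelve. all: by end_near. Qed.

End CenteredExpansion.

Local Open Scope classical_set_scope.
Local Open Scope ring_scope.

Theorem theorem9 (R : realType)
    (mu : forall n : nat, probability (unitary_borel R n) R)
    (haar_mu : forall n : nat, haar_unitary (mu n))
    (Wg : forall m : nat, nat -> 'S_m -> R)
    (WgP : weingarten_family mu Wg)
    (k : nat) (k_even : ~~ odd k)
    (T : nat) (pi : 'I_T -> {set 'I_k}) (pi_part : labelled_partition pi)
    (eps : {ffun 'I_k -> bool}) (eps_bal : balanced eps)
    (p q : {set {set 'I_k}})
    (pP : p \in pair_partitions eps) (qP : q \in pair_partitions eps) :
  exists num den : {poly R},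
    [/\ den != 0,
        (forall n : nat, (k./2 <= n)%N ->
           den.[n%:R] != 0 /\
           centered_wg Wg eps pi p q n = num.[n%:R] / den.[n%:R])
      & exists r : R, forall x : R, r < `|x| ->
          let c := fun g : nat =>
            #|wg_paths eps pi p q (2 * g)|%:R * x ^- (2 * g) in
          cvgn (series c) /\
          num.[x] / den.[x] =
            (-1) ^+ quot_len eps p q * x ^- (k./2 + quot_len eps p q)
              * limn (series c)].
Proof.
have [num [den [fE hE]]] := centered_rational_agree pi pP qP WgP eps_bal.
have den_neq0 : den != 0.
  by have [+ _] := fE _ (leqnn _); apply: contraNneq => ->; rewrite horner0.
exists num, den; split=> //.
(* Off the roots of [P], neither [den] nor any Gram determinant of degree $m\le k$ vanishes. *)
pose P := den * \prod_(m < k.+1) wg_den R m.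
have P0 : P != 0.
  by rewrite mulf_neq0 //; apply/prodf_neq0 => m _; apply: wg_den_neq0 WgP _.
(* Beyond the first bound [P] has no root; beyond the second the monotone series in $1/x$
   converge. *)
exists (Num.max (cauchy_bound P) (k * k)%:R) => x; rewrite gt_max => /andP[bound_x large_x].
have Px : P.[x] != 0.
  by apply: contraTneq bound_x => /(cauchy_boundP P0) lt_x; rewrite -leNgt ltW.
have x0 : x != 0.
  by rewrite -normr_gt0 (le_lt_trans _ large_x).
have small_x : `|x^-1| * (k * k)%:R < 1.
  by rewrite normfV mulrC ltr_pdivrMr ?normr_gt0 // mul1r.
move: Px; rewrite hornerM mulf_eq0 negb_or horner_prod => /andP[denx /prodf_neq0 wg_denx].
have den0 m : (m <= k)%N -> (wg_den R m).[x] != 0.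
  by rewrite -ltnS => lt_m; apply: (wg_denx (Ordinal lt_m)).
rewrite -hE // -(card_minus_set eps_bal).
exact: centered_rat_expansion.
Qed.
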